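(* Let $S = A_6$, the alternating group on $\{1,\ldots,6\}$, contained in the symmetric group $S_6$. Then the following hold. (a) $\sigma(S) = 2/3$, and for $s \in S^\times$ one has $\sigma(S,s) = 2/3$ exactly when $s$ has order $5$. (b) For $s \in S$ of order $5$, $\mathcal{M}(S,s)$ consists of two nonconjugate groups isomorphic to $A_5$. (c) $P(S) = 5/9$, and for $s \in S^\times$ one has $P(S,s) = 5/9$ exactly when $s$ has order $5$. (d) For each $g \in S$, at least one of the elements $x \in \{(1,2)(3,4),\ (1,3)(2,4),\ (1,4)(2,3)\}$ has the property that $\langle g, x\rangle$ is a proper subgroup of $S$. (e) Both the spread and the uniform spread of $S$ are exactly two, where for the uniform spread the class can be taken to consist of elements $s$ of order $4$. (f) For all nonidentity $x, y \in S_6$ there is $s \in S_6$ such that $S \subseteq \langle x, s\rangle \cap \langle y, s\rangle$. It is not always possible to find $s \in S$ with this property (i.e. there are nonidentity $x,y \in S_6$ for which no $s \in S$ works), nor to find $s$ in a prescribed conjugacy class of $S_6$ (i.e. for every conjugacy class $C$ of $S_6$ there are nonidentity $x, y \in S_6$ for which no $s \in C$ works). (g) $\sigma(\mathrm{PGL}(2,9)) = 1/6$ and $\sigma(M_{10}) = 1/9$, and these values are attained for elements $s$ of order $10$ and $8$, respectively.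
   Context: For a finite group $G$ let $G^\times = G \setminus \{1\}$. For $s \in G^\times$, $\mathcal{M}(G,s)$ is the set of all maximal subgroups of $G$ containing $s$. For $M \le G$, $1_M^G$ is the permutation character of $G$ on the right cosets of $M$. For $g \in G^\times$ set $\sigma(g,s) = \sum_{M \in \mathcal{M}(G,s)} 1_M^G(g)/1_M^G(1)$, $\sigma(G,s) = \max\{\sigma(g,s) : g \in G^\times\}$, $\sigma(G) = \min\{\sigma(G,s) : s \in G^\times\}$. For the simple group $S$, $P(g,s) = |\{h \in S : \langle s^h, g\rangle \neq S\}|/|S|$, $P(S,s) = \max\{P(g,s) : g \in S^\times\}$, $P(S) = \min\{P(S,s) : s \in S^\times\}$. $S$ has spread at least $k$ if for any $g_1,\ldots,g_k \in S^\times$ there is $s \in S$ with $\langle g_i, s\rangle = S$ for $1 \le i \le k$; it has uniform spread at least $k$ if there is a fixed conjugacy class $C$ of $S$ such that $s$ can always be chosen in $C$. The (uniform) spread is exactly $k$ if it is at least $k$ but not at least $k+1$. $\mathrm{PGL}(2,9)$ and $M_{10}$ are the two groups $A_6.2$ between $A_6$ and $\mathrm{Aut}(A_6)$ that are not isomorphic to $S_6$; $M_{10}$ is the one that is a non-split extension of $A_6$. *)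

(* Defs.v *)
From HB Require Import structures.
From mathcomp Require Import all_boot all_order all_algebra.
From mathcomp Require Import all_fingroup all_solvable.

Set Implicit Arguments.
Unset Strict Implicit.
Unset Printing Implicit Defensive.

Import Order.TTheory GroupScope.

(* Maximum and minimum of [f] over [A]; the value 0 for [A = set0] is junk. *)
Definition max_over (T : finType) (A : {set T}) (f : T -> rat) : rat :=
  if [pick x in A] is Some x0 then f [arg max_(x > x0 in A) f x]%O else 0%R.

Definition min_over (T : finType) (A : {set T}) (f : T -> rat) : rat :=
  if [pick x in A] is Some x0 then f [arg min_(x < x0 in A) f x]%O else 0%R.

Lemma max_overP (T : finType) (A : {set T}) (f : T -> rat) (m : rat) :
    A != set0 ->
  max_over A f = m <->
  (exists2 x, x \in A & f x = m) /\ (forall y, y \in A -> (f y <= m)%O).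
Proof.
case/set0Pn=> a Aa; rewrite /max_over; case: pickP => [x0 Ax0|/(_ a)/negP//].
case: Order.TotalTheory.arg_maxP => // x Ax maxx; split=> [<-|[[y Ay <-] maxy]].
  by split; [exists x | exact: maxx].
by apply/le_anti/andP; split; [exact: maxy | exact: maxx].
Qed.

Lemma min_overP (T : finType) (A : {set T}) (f : T -> rat) (m : rat) :
    A != set0 ->
  min_over A f = m <->
  (exists2 x, x \in A & f x = m) /\ (forall y, y \in A -> (m <= f y)%O).
Proof.
case/set0Pn=> a Aa; rewrite /min_over; case: pickP => [x0 Ax0|/(_ a)/negP//].
case: Order.TotalTheory.arg_minP => // x Ax minx; split=> [<-|[[y Ay <-] miny]].
  by split; [exists x | exact: minx].
by apply/le_anti/andP; split; [exact: minx | exact: miny].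
Qed.

Section Sigma.

Variables (gT : finGroupType) (G : {group gT}).
Implicit Types (M : {group gT}) (g s : gT).

Definition maximals_containing s : {set {group gT}} :=
  [set M : {group gT} | maximal M G & s \in M].

(* The permutation character [1_M^G] of [G] on the right cosets of [M]. *)
Definition perm_char M g : nat := #|'Fix_(rcosets M G | 'Rs)[g]|.

Definition sigma_elt g s : rat :=
  (\sum_(M in maximals_containing s)
     (perm_char M g)%:R / (perm_char M 1%g)%:R)%R.

Definition sigma_at s : rat := max_over G^# (sigma_elt^~ s).

Definition sigma : rat := min_over G^# sigma_at.

Definition nongen_elt g s : rat :=
  (#|[set h in G | <<[set (s ^ h)%g; g]>> != G]|%:R / #|G|%:R)%R.

Definition nongen_at s : rat := max_over G^# (nongen_elt^~ s).

Definition nongen : rat := min_over G^# nongen_at.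

End Sigma.

Section Spread.

Variables (gT : finGroupType) (G : {group gT}).

(* Any [k] nonidentity elements of [G] have a common mate in [C]. *)
Definition common_mates_in (C : {set gT}) (k : nat) : Prop :=
  forall g : 'I_k -> gT, (forall i, g i \in G^#) ->
  exists2 s, s \in C & forall i, <<[set g i; s]>> = G.

Definition spread_at_least (k : nat) : Prop := common_mates_in G k.

Definition uniform_spread_at_least (k : nat) : Prop :=
  exists2 C, C \in classes G & common_mates_in C k.

Definition spread_exactly (k : nat) : Prop :=
  spread_at_least k /\ ~ spread_at_least k.+1.

Definition uniform_spread_exactly (k : nat) : Prop :=
  uniform_spread_at_least k /\ ~ uniform_spread_at_least k.+1.

End Spread.

Notation Sym6 := ('Sym_('I_6))%G.
Notation Alt6 := ('Alt_('I_6))%G.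

(* The point [k] of {1, ..., 6}, represented by the ordinal [k - 1]. *)
Definition pt (k : nat) : 'I_6 := inord k.-1.

(* The permutation (a,b)(c,d), for distinct a, b, c, d. *)
Definition double_transp (a b c d : nat) : {perm 'I_6} :=
  tperm (pt a) (pt b) * tperm (pt c) (pt d).

Definition Inn_Alt6 : {group {perm {perm 'I_6}}} := (conj_aut Alt6 @* Alt6)%G.

(* The groups of shape A_6.2 between A_6 (identified with Inn(A_6)) and
   Aut(A_6) that are not isomorphic to S_6. *)
Definition exotic_A6_ext2 (H : {group {perm {perm 'I_6}}}) : bool :=
  [&& Inn_Alt6 \subset H, H \subset Aut Alt6, #|H : Inn_Alt6| == 2 & ~~ (H \isog Sym6)].

Definition is_M10 (H : {group {perm {perm 'I_6}}}) : bool :=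
  exotic_A6_ext2 H && ~~ [splits H, over Inn_Alt6].

(* Of the two groups above, PGL(2,9) is the one other than M_10. *)
Definition is_PGL29 (H : {group {perm {perm 'I_6}}}) : bool :=
  exotic_A6_ext2 H && [splits H, over Inn_Alt6].

(* Main.v *)
Require Import Defs.
From HB Require Import structures.
From mathcomp Require Import all_boot all_order all_algebra.
From mathcomp Require Import all_fingroup all_solvable.

Set Implicit Arguments.
Unset Strict Implicit.
Unset Printing Implicit Defensive.

Import GroupScope.

(** Permutations of [{0, ..., n - 1}] are encoded by their lists of images, and
    every finite enumeration is carried out on these codes.

    If [s] lies in the subgroups [M1], [M2] of equal order and [<s, h> = G] for
    every [h] outside [M1 :|: M2], then [M1] and [M2] are exactly the maximal
    subgroups of [G] over [s], because a group is never the union of two proper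
    subgroups; it suffices to test one [h] per [<s>]-[<s>] double coset.  This
    determines [sigma(G, s)] for the optimal [s].  For most other [s] the bound
    [P(g, s) <= sigma(g, s)] is enough, and [P(g, s)] is bounded from below by
    displaying proper subgroups over [s].

    For the groups [A_6.2], an automorphism of [A_6] that fixes [x] of order 4
    is determined by the image of a second generator, which has to satisfy two
    relators over [x]; this gives [|Aut(A_6)| <= 90 * 16 = 1440].  Hence [S_6],
    [PGL(2,9)] and [M_10], acting by conjugation on their subgroups [A_6],
    provide all the subgroups of [Aut(A_6)] containing [Inn(A_6)] with index 2,
    and the latter two can be studied as permutation groups of degree 10. *)

(** Part (e) cannot be read off from [P]: a value [P(S, s)] below 1/2 would give a common mate for
    any two elements by counting, but [P(S)] is 5/9. Common mates are therefore certified
    explicitly. Conjugating both elements at once brings the first to a class representative, so the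
    certificates only have to treat representatives against all elements; the same scheme serves
    (f), where mates from several classes are needed.

    In (f) the group is [S_6] but only [A_6] has to be covered. For this reason the generation tests
    carry a subgroup [T] of [G] and ask whether [T] lies in the generated group; for the other parts
    [T = G].

    Every value of sigma and [P] is written as a natural number over [|G|], which turns each claim
    into a count: 240 and 200 out of 360 for [A_6], 120 and 80 out of 720 for the groups of (g).

    The subgroups were found beforehand and are only checked here. A list of products of generators
    always bounds the generated group from below; it bounds it from above once it is closed. So
    showing that elements generate needs no closure test, and showing that a subgroup is proper
    does. *)

(** * Permutation codes and orbit computations *)

Notation raw := (seq nat).

(** First [s], then [t]: permutations act on the right, as in [permM]. *)
Definition rmul (s t : raw) : raw := [seq nth 0 t i | i <- s].
Definition rinv (s : raw) : raw := [seq index i s | i <- iota 0 (size s)].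
Definition rconj (s t : raw) : raw := rmul (rmul (rinv t) s) t.
Fixpoint rpow (n : nat) (s : raw) (k : nat) : raw :=
  if k is k'.+1 then rmul s (rpow n s k') else iota 0 n.

(** Sets of codes are stored as tries, so that the cost of a membership test depends on the degree
    and not on the size of the set. *)
Inductive trie := Trie of bool & seq trie.
Definition tnil := Trie false [::].

Fixpoint tmem (t : trie) (k : raw) {struct k} : bool :=
  match k, t with
  | [::], Trie b _ => b
  | i :: k', Trie _ ts => tmem (nth tnil ts i) k'
  end.

Fixpoint tadd (k : raw) (t : trie) {struct k} : trie :=
  match k, t with
  | [::], Trie _ ts => Trie true ts
  | i :: k', Trie b ts => Trie b (set_nth tnil ts i (tadd k' (nth tnil ts i)))
  end.

Lemma tmem_nil k : tmem tnil k = false.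
Proof. by elim: k => //= i k IHk; rewrite nth_nil. Qed.

Lemma tmem_add k t j : tmem (tadd k t) j = (j == k) || tmem t j.
Proof.
elim: k t j => [|i k IHk] [b ts] [|j l] //=.
rewrite nth_set_nth /= eqseq_cons; case: eqP => [->|] //=; exact: IHk.
Qed.

Definition tadds (l : seq raw) (t : trie) : trie := foldr tadd t l.
Definition tof (l : seq raw) : trie := tadds l tnil.

Lemma tmem_adds l t k : tmem (tadds l t) k = (k \in l) || tmem t k.
Proof. by elim: l => //= x l IHl; rewrite tmem_add IHl inE orbA. Qed.

Lemma tmem_of l k : tmem (tof l) k = (k \in l).
Proof. by rewrite tmem_adds tmem_nil orbF. Qed.

Fixpoint tuniq (t : trie) (l : seq raw) : bool :=
  if l is x :: l' then ~~ tmem t x && tuniq (tadd x t) l' else true.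

Lemma tuniqP l t : tuniq t l -> uniq l /\ {in l, forall x, ~~ tmem t x}.
Proof.
elim: l t => //= x l IHl t /andP[tx /IHl[-> lx]]; split.
  rewrite andbT; apply/negP=> /lx; by rewrite tmem_add eqxx.
by move=> y; rewrite inE => /predU1P[->|/lx] //; rewrite tmem_add negb_or => /andP[].
Qed.

(* The orbit of the elements of [todo] under the functions [fs]; only its
   soundness [orb_ind] is proved, completeness is checked on the result. *)
Fixpoint orb_rec (fuel : nat) (fs : seq (raw -> raw)) (todo acc : seq raw)
    (seen : trie) : seq raw :=
  match fuel, todo with
  | fuel'.+1, x :: todo' =>
    let step st f := let y := f x in
      if tmem st.2 y then st else (y :: st.1, tadd y st.2) in
    let st := foldl step (todo', seen) fs in
    orb_rec fuel' fs st.1 (x :: acc) st.2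
  | _, _ => acc
  end.

(** Each unit of fuel processes one element, and no group treated here has more than 720; a
    truncated list would fail the closure test. *)
Definition orb (fs : seq (raw -> raw)) (x : raw) : seq raw :=
  orb_rec 1000 fs [:: x] [::] (tof [:: x]).

Lemma orb_ind (P : raw -> Prop) (fs : seq (raw -> raw)) (x : raw) :
  P x -> (forall k y, k < size fs -> P y -> P (nth id fs k y)) ->
  {in orb fs x, forall y, P y}.
Proof.
move=> Px Pf; rewrite /orb; move: 1000 (tof _) => fuel seen.
suffices gen todo acc : {in todo, forall y, P y} -> {in acc, forall y, P y} ->
    {in orb_rec fuel fs todo acc seen, forall y, P y}.
  by apply: gen => // y; rewrite inE => /eqP->.
elim: fuel todo acc seen => [|fuel IHf] todo acc seen Ptodo Pacc //.
case: todo Ptodo => // z todo Ptodo; rewrite /orb_rec -/orb_rec; apply: IHf; last first.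
  by move=> y; rewrite inE => /predU1P[->|/Pacc//]; apply: Ptodo; rewrite mem_head.
have Pz : P z by apply: Ptodo; rewrite mem_head.
have {Ptodo} : {in todo, forall y, P y}.
  by move=> y ty; apply: Ptodo; rewrite inE ty orbT.
move: fs Pf => fs0 Pf0; rewrite -[todo]/((todo, seen).1).
have {Pf0} : forall k, k < size fs0 -> P (nth id fs0 k z).
  by move=> k /Pf0 H; apply: H.
elim: fs0 (todo, seen) => //= f fs0 IHfs st Pfs Pst; apply: IHfs => [k kfs|].
  exact: (Pfs k.+1).
case: ifP => //= _ y; rewrite inE => /predU1P[->|]; [exact: (Pfs 0) | exact: Pst].
Qed.

(** Right multiplication by generators suffices, without inverses, because the groups are finite. *)
Definition rclos (n : nat) (gs : seq raw) : seq raw :=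
  orb [seq rmul^~ g | g <- gs] (iota 0 n).

Definition rclass (gs : seq raw) (r : raw) : seq raw :=
  orb [seq rconj^~ g | g <- gs] r.

Definition rdcoset (gs : seq raw) (h : raw) : seq raw :=
  orb ([seq rmul^~ g | g <- gs] ++ [seq rmul g | g <- gs]) h.

Definition rclosed (n : nat) (gs l : seq raw) : bool :=
  let t := tof l in
  tmem t (iota 0 n) && all (fun x => all (fun g => tmem t (rmul x g)) gs) l.

(** Everything is relative to [G]: for groups of automorphisms the code is transported through the
    inverse of an injective morphism and means nothing outside the image. *)
Record coding (gT : finGroupType) (G : {group gT}) (enc : gT -> raw) (n : nat)
    (els : seq raw) : Prop := Coding {
  cod_inj : {in G &, injective enc};
  codM : {in G &, {morph enc : x y / x * y >-> rmul x y}};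
  codV : {in G, {morph enc : x / x^-1 >-> rinv x}};
  cod1 : enc 1 = iota 0 n;
  cod_els : forall e, e \in els <-> exists2 x, x \in G & e = enc x;
  cod_uniq : uniq els }.

Section Generated.

Variables (gT : finGroupType) (G : {group gT}) (enc : gT -> raw) (n : nat).
Hypotheses (inj : {in G &, injective enc})
  (encM : {in G &, {morph enc : x y / x * y >-> rmul x y}})
  (enc1 : enc 1 = iota 0 n).

Lemma rclos_sound gs : {subset gs <= G} ->
  {in rclos n [seq enc g | g <- gs],
     forall e, exists2 x, x \in <<[set g in gs]>> & e = enc x}.
Proof.
move=> sG; apply: orb_ind => [|k y]; first by exists 1; rewrite ?group1.
rewrite !size_map => kgs [x xgs ->].
have Ggs : <<[set g in gs]>> \subset G.
  by rewrite gen_subG; apply/subsetP=> g; rewrite inE => /sG.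
have kG := mem_nth 1 kgs; exists (x * nth 1 gs k).
  by rewrite groupM // mem_gen // inE.
rewrite (nth_map [::]) ?size_map // (nth_map 1) // encM //; last exact: sG.
exact: (subsetP Ggs).
Qed.

Lemma mem_rclos gs (l := rclos n [seq enc g | g <- gs]) :
    {subset gs <= G} -> rclosed n [seq enc g | g <- gs] l ->
  {in G, forall x, (x \in <<[set g in gs]>>) = (enc x \in l)}.
Proof.
move=> sG /andP[]; rewrite tmem_of => l1 /allP lM x Gx; apply/idP/idP; last first.
  case/(rclos_sound sG)=> y ygs exy.
  have Ggs : <<[set g in gs]>> \subset G.
    by rewrite gen_subG; apply/subsetP=> g; rewrite inE => /sG.
  by rewrite (inj _ _ exy) // (subsetP Ggs).
pose A := [set y in G | enc y \in l].
(* Each generator maps [A] into itself by right multiplication, hence onto itself by finiteness. So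
   the stabilizer of [A], which is a group, contains all that is generated; applied to 1 in [A],
   this gives the claim. *)
have sgA : <<[set g in gs]>> \subset 'N(A | 'R).
  rewrite gen_subG; apply/subsetP=> g; rewrite inE => gg.
  have Gg := sG _ gg.
  have stab z : z \in A -> z * g \in A.
    rewrite !inE => /andP[Gz lz]; rewrite groupM //= encM //.
    by have /allP/(_ _ (map_f enc gg)) := lM _ lz; rewrite tmem_of.
  have Ag : A :* g = A.
    apply/eqP; rewrite eqEcard card_rcoset leqnn andbT.
    by apply/subsetP=> _ /rcosetP[z Az ->]; exact: stab.
  by apply/astabsP=> y /=; rewrite -{1}Ag mem_rcoset mulgK.
move=> /(subsetP sgA)/astabsP/(_ 1) /=.
rewrite mul1g !inE group1 enc1 l1 Gx /=; exact.
Qed.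

End Generated.

Lemma coding_gen (gT : finGroupType) (enc : gT -> raw) (n : nat) (gs : seq gT)
    (es := [seq enc g | g <- gs]) (els := rclos n es) :
    injective enc -> {morph enc : x y / x * y >-> rmul x y} ->
    {morph enc : x / x^-1 >-> rinv x} -> enc 1 = iota 0 n ->
    rclosed n es els && tuniq tnil els ->
  coding <<[set g in gs]>> enc n els.
Proof.
move=> inj encM encV enc1 /andP[cl /tuniqP[u _]].
have inj' : {in [set: gT]%G &, injective enc} by move=> x y _ _; exact: inj.
have encM' : {in [set: gT]%G &, {morph enc : x y / x * y >-> rmul x y}}.
  by move=> x y _ _; exact: encM.
have sT : {subset gs <= [set: gT]%G} by move=> x _; rewrite inE.
split=> // [x y _ _|e]; first exact: inj.
split=> [/(rclos_sound encM' enc1 sT)//|[x xg ->]].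
by rewrite -(mem_rclos inj' encM' enc1 sT cl) ?inE.
Qed.

Lemma coding_injm (gT rT : finGroupType) (K : {group gT}) enc n els
    (f : {morphism K >-> rT}) (injf : 'injm f) :
  coding K enc n els -> coding (f @* K) (enc \o invm injf) n els.
Proof.
case=> inj encM encV enc1 Eels uels.
have fK x : x \in f @* K -> invm injf x \in K.
  by move=> fx; rewrite -(im_invm injf); apply: mem_morphim.
split=> //.
- move=> x y fx fy /inj /= e; have := injmP (injm_invm injf) x y fx fy; apply.
  by apply: e; exact: fK.
- by move=> x y fx fy /=; rewrite morphM // encM ?fK.
- by move=> x fx /=; rewrite morphV // encV ?fK.
- by rewrite /= morph1.
move=> e; split=> [/Eels[x Kx ->]|[x Kx ->]].
  by exists (f x); rewrite ?mem_morphim //= invmE.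
by apply/Eels; exists (invm injf x); rewrite ?fK.
Qed.

(** * Fusion counts and generation in finite groups *)

Section GroupFacts.

Variables (gT : finGroupType) (G : {group gT}).
Implicit Types (M K : {group gT}) (g s x y : gT).

Definition fusion_count M g : nat := #|[set x in G | g ^ x \in M]|.

Lemma fusion_countV M g : #|[set x in G | g ^ x^-1 \in M]| = fusion_count M g.
Proof.
rewrite /fusion_count -card_invg; congr #|pred_of_set _|; apply/setP=> x.
by rewrite !inE groupV invgK.
Qed.

(** The coset of [x] is fixed by [g] exactly when [g ^ x^-1] lies in [M]. The set of these [x] is
    thus a union of cosets of [M], one for each fixed point. *)
Lemma perm_char_fusion M g :
  M \subset G -> (perm_char G M g * #|M|)%N = fusion_count M g.
Proof.
move=> sMG; rewrite -fusion_countV; set B := [set x in G | _].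
rewrite (@card_uniform_partition _ #|M| (rcosets M B) B).
- rewrite /perm_char; congr (_ * _)%N; congr #|pred_of_set _|; apply/setP=> C.
  rewrite inE; apply/andP/rcosetsP => [[/rcosetsP[x Gx ->]]|[x]].
    rewrite sub_afixRs_norms sub1set mem_conjg => gx.
    by exists x; rewrite // inE Gx.
  rewrite inE => /andP[Gx gx] ->.
  rewrite sub_afixRs_norms sub1set mem_conjg gx; split=> //.
  by apply/rcosetsP; exists x.
- by move=> _ /rcosetsP[x _ ->]; exact: card_rcoset.
have MB : M * B = B.
  apply/eqP; rewrite eqEsubset mulG_subr andbT.
  apply/subsetP=> _ /mulsgP[m x Mm Bx ->]; move: Bx; rewrite !inE.
  case/andP=> Gx gx; rewrite (groupM (subsetP sMG _ Mm) Gx) invMg conjgM.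
  by rewrite groupJ // groupV.
rewrite -{2}MB.
have [P1 P2 P3] := and3P (rcosets_partition sMG).
have sB : rcosets M B \subset rcosets M G.
  by apply: imsetS; apply/subsetP=> x; rewrite inE => /andP[].
apply/and3P; split; last by apply: contra P3; exact: (subsetP sB).
  apply/eqP; rewrite /cover; apply/setP=> y; apply/bigcupP/mulsgP.
    by case=> _ /rcosetsP[x Bx ->] /rcosetP[m Mm ->]; exists m x.
  case=> m x Mm Bx ->; exists (M :* x); first by apply/rcosetsP; exists x.
  by apply/rcosetP; exists m.
exact: (trivIsetS sB).
Qed.

(** At the identity the fusion count is [|G|], so each quotient of character values is a fusion
    count over the common denominator [|G|]. *)
Lemma sigma_elt_fusion g s : sigma_elt G g s =
  ((\sum_(M in maximals_containing G s) fusion_count M g)%:R / #|G|%:R)%R.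
Proof.
rewrite /sigma_elt GRing.natr_sum GRing.mulr_suml; apply: eq_bigr => M.
rewrite inE => /andP[/maxgroupp/andP[sMG _] _].
have := perm_char_fusion 1 sMG; have <- := perm_char_fusion g sMG.
rewrite /fusion_count; have -> : [set x in G | 1 ^ x \in M] = G.
  by apply/setP=> x; rewrite inE conj1g group1 andbT.
move=> <-; rewrite !GRing.natrM -GRing.mulf_div GRing.divff ?GRing.mulr1 //.
by rewrite (Num.Theory.pnatr_eq0 rat) -lt0n.
Qed.

Lemma genJ2 x y z : <<[set x ^ z; y ^ z]>> = <<[set x; y]>> :^ z.
Proof. by rewrite -genJ conjUg !conjg_set1. Qed.

Lemma gen2_neqE x y : x \in G -> y \in G ->
  (<<[set x; y]>> != G) = ~~ (G \subset <<[set x; y]>>).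
Proof.
move=> Gx Gy; rewrite eqEsubset.
suff -> : <<[set x; y]>> \subset G by [].
by rewrite gen_subG; apply/subsetP=> z /set2P[] ->.
Qed.

(** Here [g] is conjugated instead of [s], which gives the same count by inverting [x]. It keeps
    [s], and hence the list of subgroups over [s], fixed. *)
Definition nongen_count g s : nat :=
  #|[set x in G | ~~ (G \subset <<[set g ^ x; s]>>)]|.

Lemma nongen_elt_count g s : g \in G -> s \in G ->
  nongen_elt G g s = ((nongen_count g s)%:R / #|G|%:R)%R.
Proof.
move=> Gg Gs; congr (_%:R / _)%R; rewrite /nongen_count -card_invg.
congr #|pred_of_set _|; apply/setP=> x; rewrite !inE groupV.
apply: andb_id2l => Gx; rewrite gen2_neqE ?groupJ ?groupV //.
by rewrite -(conjSg _ _ x) -genJ2 -conjgM mulVg conjg1 conjGid // setUC.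
Qed.

(** A union bound: if [g ^ x] and [s] do not generate [G], both lie in some maximal subgroup over
    [s]. *)
Lemma nongen_le_sigma g s : g \in G -> s \in G ->
  nongen_count g s <= \sum_(M in maximals_containing G s) fusion_count M g.
Proof.
move=> Gg Gs.
apply: (@leq_trans #|\bigcup_(M in maximals_containing G s) [set x in G | g ^ x \in M]|).
  apply/subset_leq_card/subsetP=> x; rewrite inE => /andP[Gx].
  rewrite -gen2_neqE ?groupJ // => ngen.
  have sG : <<[set g ^ x; s]>> \subset G.
    by rewrite gen_subG; apply/subsetP=> z /set2P[] ->; rewrite ?groupJ.
  have [/= e|[M maxM sM]] := maximal_exists sG; first by rewrite e eqxx in ngen.
  apply/bigcupP; exists M; rewrite inE.
    by rewrite maxM (subsetP sM) // mem_gen // !inE eqxx orbT.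
  by rewrite Gx (subsetP sM) // mem_gen // !inE eqxx.
elim/big_rec2: _ => [|M n A _ IH]; first by rewrite cards0.
by apply: leq_trans (leq_card_setU _ _) _; rewrite leq_add2l.
Qed.

Lemma subset_union2 K M1 M2 : K \subset M1 :|: M2 -> K \subset M1 \/ K \subset M2.
Proof.
move=> sK; case s1: (K \subset M1); first by left.
right; apply/subsetP=> x Kx; have /subsetPn[y Ky M1y] := negbT s1.
have M2y : y \in M2 by have /setUP[yM|//] := subsetP sK _ Ky; rewrite yM in M1y.
have /setUP[M1x|//] := subsetP sK _ Kx.
(* The product of an element outside [M2] and an element outside [M1] would lie in neither
   subgroup. *)
have /setUP[] := subsetP sK _ (groupM Kx Ky).
  by rewrite groupMl // (negPf M1y).
by rewrite groupMr.
Qed.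

(** Equality of the orders rules out that one of the two lies properly inside the other and so fails
    to be maximal. The case [M1 = M2] is allowed and describes a unique maximal subgroup over
    [s]. *)
Lemma maximals_containing2 M1 M2 s :
    M1 \proper G -> M2 \proper G -> s \in M1 -> s \in M2 -> #|M1| = #|M2| ->
    (forall h, h \in G -> h \notin M1 -> h \notin M2 -> G \subset <<[set h; s]>>) ->
  maximals_containing G s = [set M1; M2].
Proof.
move=> pM1 pM2 M1s M2s eM gen.
have key K : s \in K -> K \proper G -> K \subset M1 \/ K \subset M2.
  move=> Ks /andP[sKG nGK]; apply: subset_union2; apply/subsetP=> h Kh.
  apply: contraR nGK; rewrite inE negb_or => /andP[M1h M2h].
  apply: subset_trans (gen h (subsetP sKG _ Kh) M1h M2h) _.
  by rewrite gen_subG; apply/subsetP=> z /set2P[] ->.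
have maxM M : (M \in [set M1; M2]) -> M \in maximals_containing G s.
  move=> M12; have [pM Ms cM] : [/\ M \proper G, s \in M & #|M| = #|M1|].
    by case/set2P: M12 => ->.
  rewrite inE Ms andbT; have [/= e|[K maxK sMK]] := maximal_exists (proper_sub pM).
    by rewrite e properxx in pM.
  have [sK1|sK2] := key K (subsetP sMK _ Ms) (maxgroupp maxK).
    have eMK : M :=: K.
      apply/eqP; rewrite eqEcard sMK cM; exact: subset_leq_card.
    by rewrite (_ : M = K) //; apply/val_inj.
  have eMK : M :=: K.
    apply/eqP; rewrite eqEcard sMK cM eM; exact: subset_leq_card.
  by rewrite (_ : M = K) //; apply/val_inj.
apply/setP=> K; apply/idP/idP=> [|/maxM//]; rewrite inE => /andP[maxK Ks].
have [_ mK] := maxgroupP maxK; rewrite !inE.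
by have [sK|sK] := key K Ks (maxgroupp maxK);
  rewrite -!val_eqE /= -(mK _ _ sK) ?eqxx ?orbT.
Qed.

(** With the invariance lemmas that follow, this reduces both arguments of sigma and of the
    nongeneration count to class representatives. *)
Lemma maximals_containingJ s x : x \in G ->
  maximals_containing G (s ^ x) = [set (M :^ x)%G | M in maximals_containing G s].
Proof.
move=> Gx; apply/setP=> M; apply/idP/imsetP=> [|[K]].
  rewrite inE => /andP[maxM Msx]; exists (M :^ x^-1)%G.
    by rewrite inE -{1}(conjGid (groupVr Gx)) maximalJ maxM mem_conjg invgK.
  by apply/val_inj; rewrite /= conjsgKV.
rewrite inE => /andP[maxK Ks] ->.
by rewrite inE memJ_conjg Ks -{1}(conjGid Gx) maximalJ maxK.
Qed.

Lemma fusion_countJ M g x : x \in G -> fusion_count (M :^ x) g = fusion_count M g.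
Proof.
move=> Gx; rewrite /fusion_count -(card_rcoset [set y in G | g ^ y \in M] x).
congr #|pred_of_set _|; apply/setP=> y.
by rewrite mem_rcoset !inE (groupMr _ (groupVr Gx)) mem_conjg conjgM.
Qed.

Lemma fusion_count_class M g x : x \in G -> fusion_count M (g ^ x) = fusion_count M g.
Proof.
move=> Gx; rewrite /fusion_count -[RHS](card_lcoset _ x^-1).
congr #|pred_of_set _|; apply/setP=> y.
by rewrite mem_lcoset !inE invgK (groupMl _ Gx) conjgM.
Qed.

Lemma sigma_elt_class g s x : x \in G -> sigma_elt G (g ^ x) s = sigma_elt G g s.
Proof.
move=> Gx; rewrite !sigma_elt_fusion; congr (_%:R / _)%R.
by apply: eq_bigr => M _; exact: fusion_count_class.
Qed.

Lemma sigma_eltJ g s x : x \in G -> sigma_elt G g (s ^ x) = sigma_elt G g s.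
Proof.
move=> Gx; rewrite !sigma_elt_fusion maximals_containingJ //.
rewrite big_imset /= => [|M K _ _ /(congr1 val)/conjsg_inj/val_inj//].
by congr (_%:R / _)%R; apply: eq_bigr => M _; exact: fusion_countJ.
Qed.

Lemma nongen_count_class g s x : x \in G -> nongen_count (g ^ x) s = nongen_count g s.
Proof.
move=> Gx; rewrite /nongen_count -[RHS](card_lcoset _ x^-1).
congr #|pred_of_set _|; apply/setP=> y.
by rewrite mem_lcoset !inE invgK (groupMl _ Gx) conjgM.
Qed.

Lemma nongen_countJ g s x : x \in G -> nongen_count g (s ^ x) = nongen_count g s.
Proof.
move=> Gx; rewrite /nongen_count -(card_rcoset [set y in G | ~~ (G \subset <<[set g ^ y; s]>>)] x).
congr #|pred_of_set _|; apply/setP=> y; rewrite mem_rcoset !inE (groupMr _ (groupVr Gx)).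
by rewrite -(conjSg _ <<[set _; s]>> x) -genJ2 -conjgM mulgKV conjGid.
Qed.

End GroupFacts.

(** * Coded groups *)

Definition covers (n : nat) (tgt gs : seq raw) : bool :=
  let t := tof (rclos n gs) in all (tmem t) tgt.

Definition subOK (n : nat) (els tgt gs : seq raw) : bool :=
  let l := rclos n gs in
  let t := tof l in
  [&& all (mem els) gs, rclosed n gs l & has (fun e => ~~ tmem t e) tgt].

Definition inlow (ts : seq trie) (e : raw) : bool := has (tmem^~ e) ts.

Definition tries (n : nat) (gss : seq (seq raw)) : seq trie :=
  [seq tof (rclos n gs) | gs <- gss].

Definition lowOK (n : nat) (els tgt : seq raw) (gss : seq (seq raw)) (s : raw) :=
  all (subOK n els tgt) gss && all (tmem^~ s) (tries n gss).

(** [seen] collects the double cosets of the elements already tested: the group generated by [h] and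
    [gs] does not change when [h] is multiplied on either side by elements of [gs]. *)
Fixpoint gen_all (n : nat) (tgt gs todo : seq raw) (seen : trie) : bool :=
  if todo is h :: todo' then
    if tmem seen h then gen_all n tgt gs todo' seen else
    covers n tgt (h :: gs) && gen_all n tgt gs todo' (tadds (rdcoset gs h) seen)
  else true.

Definition classes_trie (gs reps : seq raw) : trie :=
  foldr (fun r t => tadds (rclass gs r) t) tnil reps.

Definition isord (n k : nat) (e : raw) : bool :=
  (rpow n e k == iota 0 n) && all (fun d => rpow n e d != iota 0 n) (iota 1 k.-1).

Definition repcover (n : nat) (els gs reps : seq raw) : bool :=
  [&& all (mem els) gs, all (mem els) reps &
      let t := classes_trie gs reps in all (fun e => (e == iota 0 n) || tmem t e) els].

Definition gen_off (n : nat) (els tgt : seq raw) (ts : seq trie) (s : raw) : bool :=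
  gen_all n tgt [:: s] [seq e <- els | ~~ inlow ts e] tnil.

Definition maxpairOK (n : nat) (els tgt gs1 gs2 : seq raw) (s : raw) : bool :=
  let t1 := tof (rclos n gs1) in let t2 := tof (rclos n gs2) in
  [&& lowOK n els tgt [:: gs1; gs2] s, gen_off n els tgt [:: t1; t2] s
    & count (tmem t1) els == count (tmem t2) els].

Definition fcount (els : seq raw) (t : trie) (g : raw) : nat :=
  count (fun e => tmem t (rconj g e)) els.

(** Counts the union of the subgroups, without multiplicity. This is what bounds [P] from below,
    whereas sigma adds the counts [fcount] of single subgroups. *)
Definition lowcount (els : seq raw) (ts : seq trie) (g : raw) : nat :=
  count (fun e => inlow ts (rconj g e)) els.

Section Coded.

Variables (gT : finGroupType) (G T : {group gT}) (enc : gT -> raw) (n : nat).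
Variables els tgt : seq raw.
Hypotheses (cG : coding G enc n els) (cT : coding T enc n tgt) (sTG : T \subset G).

Definition dec (e : raw) : gT := odflt 1 [pick x in G | enc x == e].

Lemma encK x : x \in G -> dec (enc x) = x.
Proof.
move=> Gx; rewrite /dec; case: pickP => [y /andP[Gy /eqP/(cod_inj cG)->]|/(_ x)] //.
by rewrite Gx eqxx.
Qed.

Lemma mem_enc x : x \in G -> enc x \in els.
Proof. by move=> Gx; apply/(cod_els cG); exists x. Qed.

Lemma decG e : e \in els -> dec e \in G.
Proof. by case/(cod_els cG)=> x Gx ->; rewrite encK. Qed.

Lemma decK e : e \in els -> enc (dec e) = e.
Proof. by case/(cod_els cG)=> x Gx ->; rewrite encK. Qed.

Lemma encJ x y : x \in G -> y \in G -> enc (x ^ y) = rconj (enc x) (enc y).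
Proof.
by move=> Gx Gy; rewrite conjgE mulgA !(codM cG, codV cG) ?groupM ?groupV.
Qed.

Lemma enc_pow x k : x \in G -> enc (x ^+ k) = rpow n (enc x) k.
Proof.
move=> Gx; elim: k => [|k IHk] /=; first exact: cod1 cG.
by rewrite expgS (codM cG) ?groupX ?IHk.
Qed.

Lemma enc_eq1 x : x \in G -> (enc x == iota 0 n) = (x == 1).
Proof. by move=> Gx; rewrite -(cod1 cG) (inj_in_eq (cod_inj cG)) ?group1. Qed.

Lemma isordE x k : 0 < k -> x \in G -> isord n k (enc x) = (#[x] == k).
Proof.
move=> k0 Gx; rewrite /isord -enc_pow // enc_eq1 ?groupX // -order_dvdn.
apply/andP/eqP => [[xk /allP no]|<-].
  apply/eqP; rewrite eqn_leq dvdn_leq //= leqNgt; apply/negP=> lt.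
  have /no : #[x] \in iota 1 k.-1 by rewrite mem_iota order_gt0 add1n prednK.
  by rewrite -enc_pow // enc_eq1 ?groupX // expg_order eqxx.
split=> //; apply/allP=> d; rewrite mem_iota add1n prednK ?order_gt0 //.
case/andP=> d0 lt; rewrite -enc_pow // enc_eq1 ?groupX // -order_dvdn.
by rewrite gtnNdvd.
Qed.

Lemma perm_enc : perm_eq els [seq enc x | x <- enum G].
Proof.
apply: uniq_perm; first exact: cod_uniq cG.
  rewrite map_inj_in_uniq ?enum_uniq // => x y; rewrite !mem_enum => Gx Gy.
  exact: (cod_inj cG).
move=> e; apply/idP/mapP=> [/(cod_els cG)[x Gx ->]|[x xG ->]].
  by exists x; rewrite ?mem_enum.
by rewrite mem_enum in xG; exact: mem_enc.
Qed.

Lemma card_coded : #|G| = size els.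
Proof. by rewrite (perm_size perm_enc) size_map cardE. Qed.

Lemma count_coded (p : pred raw) : #|[set x in G | p (enc x)]| = count p els.
Proof.
rewrite (seq.permP perm_enc) count_map -size_filter cardE; apply/perm_size.
apply: uniq_perm => [||x]; [exact: enum_uniq | exact/filter_uniq/enum_uniq |].
by rewrite mem_enum [in RHS]mem_filter mem_enum inE andbC.
Qed.

Lemma count_coded_eq (A : pred gT) (p : pred raw) :
  {in G, forall x, A x = p (enc x)} -> #|[set x in G | A x]| = count p els.
Proof.
move=> Ap; rewrite -count_coded; congr #|pred_of_set _|; apply/setP=> x.
by rewrite !inE; apply: andb_id2l => /Ap.
Qed.

Lemma all_coded (p : pred raw) : all p els -> {in G, forall x, p (enc x)}.
Proof. by move=> /allP pG x Gx; apply/pG/mem_enc. Qed.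

Lemma sub_gen_seq (A : seq gT) : {subset A <= G} -> <<[set g in A]>> \subset G.
Proof. by move=> sA; rewrite gen_subG; apply/subsetP=> g; rewrite inE => /sA. Qed.

Lemma covers_gen (A : seq gT) : {subset A <= G} ->
  covers n tgt [seq enc g | g <- A] -> T \subset <<[set g in A]>>.
Proof.
move=> sA /allP cov; apply/subsetP=> x Tx.
have /cov : enc x \in tgt by apply/(cod_els cT); exists x.
rewrite tmem_of => /(rclos_sound (codM cG) (cod1 cG) sA)[y yA e].
by rewrite (cod_inj cG (subsetP sTG _ Tx) (subsetP (sub_gen_seq sA) _ yA) e).
Qed.

Definition gen_of (gs : seq raw) : {group gT} := <<[set g in [seq dec e | e <- gs]]>>%G.

Lemma sub_dec gs : {subset gs <= els} -> {subset [seq dec e | e <- gs] <= G}.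
Proof. by move=> sgs _ /mapP[e /sgs/decG ? ->]. Qed.

Lemma map_enc_dec gs : {subset gs <= els} -> [seq enc g | g <- [seq dec e | e <- gs]] = gs.
Proof.
by move=> sgs; rewrite -map_comp -[RHS]map_id; apply/eq_in_map => e /sgs/decK.
Qed.

Lemma gen_of_sub gs : {subset gs <= els} -> gen_of gs \subset G.
Proof. by move=> sgs; apply: sub_gen_seq; exact: sub_dec. Qed.

Lemma mem_gen_of gs x : subOK n els tgt gs -> x \in G ->
  (x \in gen_of gs) = tmem (tof (rclos n gs)) (enc x).
Proof.
case/and3P=> /allP sgs cl _ Gx; rewrite tmem_of.
have := mem_rclos (cod_inj cG) (codM cG) (cod1 cG) (sub_dec sgs).
by rewrite map_enc_dec // => ->.
Qed.

Lemma gen_of_subG gs : subOK n els tgt gs -> gen_of gs \subset G.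
Proof. by case/and3P=> /allP sgs _ _; exact: gen_of_sub. Qed.

Lemma gen_of_notT gs : subOK n els tgt gs -> ~~ (T \subset gen_of gs).
Proof.
move=> ok; case/and3P: (ok) => _ _ /hasP[e /(cod_els cT)[x Tx ->] nt].
by apply/subsetPn; exists x; rewrite ?mem_gen_of // (subsetP sTG).
Qed.

Lemma gen_of_low gs x y : subOK n els tgt gs -> x \in gen_of gs -> y \in gen_of gs ->
  ~~ (T \subset <<[set x; y]>>).
Proof.
move=> ok xM yM; apply: contra (gen_of_notT ok) => /subset_trans; apply.
by rewrite gen_subG; apply/subsetP=> z /set2P[] ->.
Qed.

Lemma inlowP gss s x : x \in G -> s \in G -> lowOK n els tgt gss (enc s) ->
  inlow (tries n gss) (enc x) -> ~~ (T \subset <<[set x; s]>>).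
Proof.
rewrite /lowOK /inlow all_map has_map.
move=> Gx Gs /andP[/allP ok /allP sM] /hasP[gs gss_gs xM].
have okgs := ok _ gss_gs; apply: (gen_of_low okgs); rewrite mem_gen_of //.
exact: sM.
Qed.

Lemma gen_allP gs todo : {subset gs <= els} -> {subset todo <= els} ->
  gen_all n tgt gs todo tnil ->
  {in G, forall x, enc x \in todo -> T \subset <<x |: [set g in [seq dec e | e <- gs]]>>}.
Proof.
move=> sgs; set A := [set g in _].
have sAG : A \subset G by apply/subsetP=> g; rewrite inE; exact: sub_dec.
(* Invariant of the search: every code in [seen] belongs to an element that covers [T] together with
   [A]. *)
pose P e := exists x, [/\ x \in G, e = enc x & T \subset <<x |: A>>].
have: forall e, tmem tnil e -> P e by move=> e; rewrite tmem_nil.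
suffices gen todo' seen : (forall e, tmem seen e -> P e) -> {subset todo' <= els} ->
    gen_all n tgt gs todo' seen -> {in todo', forall e, P e}.
  move=> Pnil stodo ga x Gx /(gen _ _ Pnil stodo ga)[y [Gy e Ty]].
  by rewrite (cod_inj cG _ _ e).
elim: todo' seen => //= h todo' IH seen Pseen stodo.
have s' : {subset todo' <= els} by move=> e et; apply: stodo; rewrite inE et orbT.
have hels : h \in els by apply: stodo; rewrite mem_head.
case: ifP => [sh /(IH _ Pseen s') Pt e|_ /andP[cov]].
  by rewrite inE => /predU1P[->|/Pt //]; exact: Pseen.
have Ph : P h.
  exists (dec h); rewrite decG ?decK //; split=> //.
  have : {subset dec h :: [seq dec e | e <- gs] <= G}.
    by move=> y; rewrite inE => /predU1P[->|/sub_dec]; [exact: decG|exact].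
  move/covers_gen; rewrite /= decK // map_enc_dec // => /(_ cov).
  by congr (T \subset <<_>>); apply/setP=> z; rewrite !inE.
move=> /IH Pt e; rewrite inE => /predU1P[->|]; first by [].
apply: Pt => // {}e; rewrite tmem_adds => /orP[|/Pseen//]; apply: orb_ind => //.
(* Replacing [x] by [x * a] or [a * x] with [a] in [A] loses nothing, so the invariant passes to the
   whole double coset. *)
have gen_step (x y a : gT) : a \in A -> (x = y * a^-1) \/ (x = a^-1 * y) ->
    <<x |: A>> \subset <<y |: A>>.
  move=> aA xy; rewrite gen_subG subUset sub1set.
  have gA b : b \in A -> b \in <<y |: A>> by move=> bA; rewrite mem_gen // inE bA orbT.
  have gy : y \in <<y |: A>> by rewrite mem_gen // !inE eqxx.
  apply/andP; split; last by apply/subsetP.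
  have gaV := groupVr (gA _ aA).
  by case: xy => ->; [exact: (groupM gy gaV) | exact: (groupM gaV gy)].
move=> k _ kfs [x [Gx -> Tx]].
have Pstep a y : a \in A -> y \in G -> (x = y * a^-1) \/ (x = a^-1 * y) -> P (enc y).
  by move=> aA Gy xy; exists y; split=> //; apply: subset_trans Tx (gen_step _ _ _ aA xy).
have dA e1 : e1 \in gs -> [/\ dec e1 \in A, dec e1 \in G & enc (dec e1) = e1].
  by move=> ge; rewrite inE map_f ?decG ?decK //; exact: sgs.
move: kfs; rewrite size_cat !size_map nth_cat size_map; case: (ltnP k (size gs)) => [lt _|le lt].
  rewrite (nth_map [::]) //; have [aA aG ea] := dA _ (mem_nth [::] lt).
  rewrite -ea -(codM cG) //; apply: (Pstep _ _ aA); first exact: groupM.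
  by left; rewrite mulgK.
have {}lt : k - size gs < size gs by rewrite ltn_subLR.
rewrite (nth_map [::]) //; have [aA aG ea] := dA _ (mem_nth [::] lt).
rewrite -ea -(codM cG) //; apply: (Pstep _ _ aA); first exact: groupM.
by right; rewrite mulKg.
Qed.

Lemma rclass_sound gs r : {subset gs <= els} -> r \in els ->
  {in rclass gs r, forall e, exists2 x, x \in G & e = enc (dec r ^ x)}.
Proof.
move=> sgs rels; apply: orb_ind => [|k y].
  by exists 1; rewrite ?group1 // conjg1 decK.
rewrite size_map => lt [x Gx ->]; have ge := sgs _ (mem_nth [::] lt).
exists (x * dec (nth [::] gs k)); first by rewrite groupM ?decG.
rewrite (nth_map [::]) // -{1}(decK ge) conjgM -encJ ?groupJ ?decG //.
Qed.

Lemma repcoverP gs reps : repcover n els gs reps ->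
  {in G^#, forall x, exists r y, [/\ r \in reps, r \in els, y \in G & x = dec r ^ y]}.
Proof.
case/and3P=> /allP sgs /allP srep /allP cov x /setD1P[x1 Gx].
have /cov := mem_enc Gx; rewrite enc_eq1 // (negPf x1) /=.
rewrite /classes_trie {cov}; elim: reps srep => /= [|r reps IH] srep.
  by rewrite tmem_nil.
rewrite tmem_adds => /orP[xr|/IH].
  have rels : r \in els by apply: srep; rewrite mem_head.
  have [y Gy e] := rclass_sound sgs rels xr; exists r, y; rewrite mem_head; split=> //.
  by apply: (cod_inj cG); rewrite ?groupJ ?decG.
case=> [r' rr|r' [y [rr' ? ? ?]]]; first by apply: srep; rewrite inE rr orbT.
by exists r', y; split=> //; rewrite inE rr' orbT.
Qed.

Lemma gen_offP ts s : s \in G -> gen_off n els tgt ts (enc s) ->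
  {in G, forall x, ~~ inlow ts (enc x) -> T \subset <<[set x; s]>>}.
Proof.
move=> Gs ok x Gx nx.
have s1 : {subset [:: enc s] <= els} by move=> e; rewrite inE => /eqP->; exact: mem_enc.
have s2 : {subset [seq e <- els | ~~ inlow ts e] <= els}.
  by move=> e; rewrite mem_filter => /andP[].
have := gen_allP s1 s2 ok Gx; rewrite mem_filter nx mem_enc //= encK //.
by move/(_ isT); congr (_ \subset <<_>>); apply/setP=> z; rewrite !inE.
Qed.

Lemma card_gen_of gs : subOK n els tgt gs -> #|gen_of gs| = count (tmem (tof (rclos n gs))) els.
Proof.
move=> ok; rewrite -(setIidPr (gen_of_subG ok)).
rewrite -(count_coded_eq (A := fun x => x \in gen_of gs)) => [|x Gx]; last exact: mem_gen_of.
by congr #|pred_of_set _|; apply/setP=> x; rewrite !inE.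
Qed.

Lemma fusion_count_gen_of gs g : subOK n els tgt gs -> g \in G ->
  fusion_count G (gen_of gs) g = fcount els (tof (rclos n gs)) (enc g).
Proof.
by move=> ok Gg; apply: count_coded_eq => x Gx; rewrite mem_gen_of ?groupJ ?encJ.
Qed.

End Coded.

Section CodedGroup.

Variables (gT : finGroupType) (G : {group gT}) (enc : gT -> raw) (n : nat).
Variable els : seq raw.
Hypothesis cG : coding G enc n els.

Local Notation sG := (subxx G).
Local Notation gen_of := (gen_of G enc).

Lemma maxpairP gs1 gs2 s : s \in G -> maxpairOK n els els gs1 gs2 (enc s) ->
  maximals_containing G s = [set gen_of gs1; gen_of gs2].
Proof.
move=> Gs /and3P[/andP[/and3P[ok1 ok2 _] /and3P[s1 s2 _]] goff /eqP ec].
have pM gs : subOK n els els gs -> gen_of gs \proper G.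
  by move=> ok; rewrite properE (gen_of_subG cG ok) (gen_of_notT cG cG sG ok).
apply: maximals_containing2; rewrite ?pM ?(mem_gen_of cG ok1) ?(mem_gen_of cG ok2) //.
  by rewrite (card_gen_of cG ok1) (card_gen_of cG ok2).
move=> h Gh; rewrite (mem_gen_of cG ok1) // (mem_gen_of cG ok2) // => h1 h2.
by apply: (gen_offP cG cG sG Gs goff) => //=; rewrite (negPf h1) (negPf h2).
Qed.

Lemma lowcount_le gss g s : g \in G -> s \in G -> lowOK n els els gss (enc s) ->
  lowcount els (tries n gss) (enc g) <= nongen_count G g s.
Proof.
move=> Gg Gs ok; rewrite /lowcount -(count_coded cG).
apply/subset_leq_card/subsetP=> x; rewrite !inE => /andP[Gx].
by rewrite Gx -(encJ cG) // => /(inlowP cG cG sG)-> //; rewrite groupJ.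
Qed.

(** The subgroups need not be maximal: it is enough that they are proper, contain [s], and that
    everything outside their union generates [G] with [s]. *)
Lemma lowcount_eq gss g s : g \in G -> s \in G -> lowOK n els els gss (enc s) ->
  gen_off n els els (tries n gss) (enc s) ->
  nongen_count G g s = lowcount els (tries n gss) (enc g).
Proof.
move=> Gg Gs ok off; apply: (count_coded_eq cG) => x Gx; rewrite -(encJ cG) //.
apply/idP/idP=> [|xl]; last by apply: (inlowP cG cG sG _ Gs ok); rewrite ?groupJ.
by apply: contraR; apply: (gen_offP cG cG sG Gs off); rewrite groupJ.
Qed.

End CodedGroup.

(** * Codes of permutations and of pairs of permutations *)

Section PermCoding.

Variable n : nat.
Implicit Types (s t : {perm 'I_n.+1}).

Definition encS s : raw := [seq val (s i) | i <- enum 'I_n.+1].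

Lemma size_encS s : size (encS s) = n.+1.
Proof. by rewrite size_map -cardE card_ord. Qed.

Lemma nth_encS s (i : 'I_n.+1) : nth 0 (encS s) i = s i.
Proof. by rewrite (nth_map i) ?nth_ord_enum // -cardE card_ord. Qed.

Lemma encS_lt s : {in encS s, forall i, i < n.+1}.
Proof. by move=> _ /mapP[i _ ->]; exact: ltn_ord. Qed.

Lemma encS_inj : injective encS.
Proof. by move=> s t e; apply/permP=> i; apply/val_inj; rewrite /= -!nth_encS e. Qed.

Lemma encSM : {morph encS : s t / s * t >-> rmul s t}.
Proof.
move=> s t; rewrite /rmul -map_comp; apply: eq_map => i /=.
by rewrite permM nth_encS.
Qed.

Lemma encSV : {morph encS : s / s^-1 >-> rinv s}.
Proof.
move=> s; rewrite /rinv size_encS -val_enum_ord -map_comp; apply: eq_map => i /=.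
rewrite -{2}(permKV s i) (index_map (f := fun j => val (s j))) ?index_enum_ord //.
by move=> j k /val_inj/perm_inj.
Qed.

Lemma encSX s k : encS (s ^+ k) = rpow n.+1 (encS s) k.
Proof.
elim: k => [|k IHk]; last by rewrite expgS encSM IHk.
by apply: etrans (val_enum_ord n.+1); apply: eq_map => i; rewrite expg0 perm1.
Qed.

Lemma encS1 : encS 1 = iota 0 n.+1.
Proof. by rewrite -val_enum_ord; apply: eq_map => i; rewrite perm1. Qed.

Lemma mem_encS s i : (i \in encS s) = (i < n.+1).
Proof.
apply/idP/idP => [/encS_lt //|lt].
by apply/mapP; exists (s^-1 (Ordinal lt)); rewrite ?mem_enum ?permKV.
Qed.

(* The identity for a list that does not list the images of a permutation. *)
Definition mkperm (l : raw) : {perm 'I_n.+1} :=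
  insubd (1 : {perm 'I_n.+1}) [ffun i : 'I_n.+1 => inord (nth 0 l i) : 'I_n.+1].

Definition validS (l : raw) := [&& size l == n.+1, all (ltn^~ n.+1) l & uniq l].

Lemma mkpermK l : validS l -> encS (mkperm l) = l.
Proof.
case/and3P=> /eqP sl /allP ltl ul.
have lt (i : 'I_n.+1) : nth 0 l i < n.+1 by apply/ltl/mem_nth; rewrite sl.
have inj : injectiveb [ffun i : 'I_n.+1 => inord (nth 0 l i) : 'I_n.+1].
  apply/injectiveP=> i j; rewrite !ffunE => /(congr1 val) /=.
  by rewrite !inordK // => /eqP; rewrite nth_uniq ?sl // => /eqP/val_inj.
apply: (@eq_from_nth _ 0); rewrite size_encS // => i ltn.
rewrite -[i]/(val (Ordinal ltn)) nth_encS /mkperm -pvalE val_insubd inj ffunE inordK //.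
Qed.

End PermCoding.

Section PairCoding.

Variables m n : nat.
Implicit Types (x y : {perm 'I_m.+1} * {perm 'I_n.+1}).

(** A pair acts on the disjoint union of the two sets of points, the second one shifted by [m.+1],
    so the orbit computations apply to pairs unchanged. *)
Definition encP x : raw := encS x.1 ++ [seq m.+1 + i | i <- encS x.2].

Lemma encP_inj : injective encP.
Proof.
move=> [x1 x2] [y1 y2] /eqP; rewrite eqseq_cat ?size_encS //= => /andP[/eqP/encS_inj->].
by move/eqP/(inj_map (@addnI m.+1))/encS_inj->.
Qed.

Lemma encPM : {morph encP : x y / x * y >-> rmul x y}.
Proof.
move=> x y; rewrite /rmul map_cat /encP /= !encSM; rewrite /rmul; congr (_ ++ _).
  apply/eq_in_map => i /encS_lt lt /=.
  by rewrite nth_cat size_encS lt.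
rewrite -[LHS](map_comp _ _ (encS x.2)) -[RHS](map_comp _ _ (encS x.2)).
apply/eq_in_map => i /encS_lt lt /=.
by rewrite nth_cat size_encS ltnNge leq_addr /= addKn (nth_map 0) ?size_encS.
Qed.

Lemma encPV : {morph encP : x / x^-1 >-> rinv x}.
Proof.
move=> x; rewrite /encP /= !encSV /rinv size_cat size_map !size_encS iotaD map_cat; congr (_ ++ _).
  apply/eq_in_map => i; rewrite mem_iota => /andP[_ lt].
  by rewrite index_cat mem_encS lt.
have -> : iota (0 + m.+1) n.+1 = [seq m.+1 + i | i <- iota 0 n.+1].
  by rewrite addnC iotaDl.
rewrite -[LHS](map_comp _ _ (iota 0 n.+1)) -[RHS](map_comp _ _ (iota 0 n.+1)).
apply/eq_in_map => i _ /=.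
rewrite index_cat mem_encS ltnNge leq_addr /= size_encS.
by rewrite (index_map (@addnI m.+1)).
Qed.

Lemma encP1 : encP 1 = iota 0 (m.+1 + n.+1).
Proof. by rewrite iotaD addnC iotaDl /encP !encS1. Qed.

End PairCoding.

(** Both projections are injective on [R] by comparing orders, so [R] is the graph of an
    isomorphism. An isomorphism is thus certified by pairing generators. *)
Lemma isog_of_pairs (gT rT : finGroupType) (R : {group gT * rT}) :
    #|@fst gT rT @* R| = #|R| -> #|@snd gT rT @* R| = #|R| ->
  @fst gT rT @* R \isog @snd gT rT @* R.
Proof.
have inj (aT : finGroupType) (f : {morphism [set: gT * rT] >-> aT}) :
    #|f @* R| = #|R| -> R \isog f @* R.
  move=> c; pose g := restrm (subsetT R) f.
  have gR : g @* R = f @* R by rewrite im_restrm.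
  by rewrite -gR; apply: sub_isog => //; rewrite -card_im_injm gR c.
move=> /inj iso1 /inj iso2.
by rewrite isog_sym in iso1; apply: isog_trans iso1 iso2.
Qed.

Lemma isog_gen_pairs (gT rT : finGroupType) (ps : seq (gT * rT)) :
    #|<<[set p in ps]>>| = #|<<[set x in [seq p.1 | p <- ps]]>>| ->
    #|<<[set p in ps]>>| = #|<<[set x in [seq p.2 | p <- ps]]>>| ->
  <<[set x in [seq p.1 | p <- ps]]>> \isog <<[set x in [seq p.2 | p <- ps]]>>.
Proof.
have im (aT : finGroupType) (f : {morphism [set: gT * rT] >-> aT}) :
    f @* <<[set p in ps]>> = <<[set x in [seq f p | p <- ps]]>>.
  rewrite morphim_gen ?subsetT // /morphim setTI; congr <<_>>.
  apply/setP=> x; rewrite inE; apply/imsetP/mapP => -[p pp ->]; exists p => //.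
    by rewrite inE in pp.
  by rewrite inE.
rewrite -(im _ (fst_morphism gT rT)) -(im _ (snd_morphism gT rT)) => c1 c2.
exact: isog_of_pairs.
Qed.

Definition codingOK (n : nat) (gs : seq raw) : bool :=
  let l := rclos n.+1 gs in [&& all (@validS n) gs, rclosed n.+1 gs l & tuniq tnil l].

Lemma mkperm_encK n gs : all (@validS n) gs ->
  [seq encS g | g <- [seq mkperm n e | e <- gs]] = gs.
Proof.
by move=> /allP v; rewrite -map_comp -[RHS]map_id; apply/eq_in_map => g /v/mkpermK.
Qed.

Lemma coding_mkperm n (gs : seq raw) : codingOK n gs ->
  coding <<[set g in [seq mkperm n e | e <- gs]]>> (@encS n) n.+1 (rclos n.+1 gs).
Proof.
case/and3P=> v cl u; have e := mkperm_encK v.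
have := @coding_gen _ (@encS n) n.+1 [seq mkperm n e | e <- gs].
rewrite /= e; apply; rewrite ?cl //; [exact: encS_inj | exact: encSM | exact: encSV |].
exact: encS1.
Qed.

Definition shift (m : nat) (e : raw) : raw := [seq m + i | i <- e].

Definition pairOK (m n : nat) (ps : seq (raw * raw)) : bool :=
  let gs := [seq p.1 ++ shift m.+1 p.2 | p <- ps] in
  let l := rclos (m.+1 + n.+1) gs in
  [&& codingOK m (unzip1 ps), codingOK n (unzip2 ps), rclosed (m.+1 + n.+1) gs l,
      tuniq tnil l, size (rclos m.+1 (unzip1 ps)) == size l
    & size (rclos n.+1 (unzip2 ps)) == size l].

Lemma isog_mkperm_pairs m n ps : pairOK m n ps ->
  <<[set g in [seq mkperm m e | e <- unzip1 ps]]>> \isog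
  <<[set g in [seq mkperm n e | e <- unzip2 ps]]>>.
Proof.
case/and5P=> ok1 ok2 cl u /andP[/eqP s1 /eqP s2].
have c1 := card_coded (coding_mkperm ok1); have c2 := card_coded (coding_mkperm ok2).
have [/and3P[v1 _ _] /and3P[v2 _ _]] := (ok1, ok2).
pose qs := [seq (mkperm m p.1, mkperm n p.2) | p <- ps].
have e : [seq encP q | q <- qs] = [seq p.1 ++ shift m.+1 p.2 | p <- ps].
  rewrite -map_comp; apply/eq_in_map => p pps /=; rewrite /encP /=.
  have p1 : p.1 \in unzip1 ps by apply: map_f.
  have p2 : p.2 \in unzip2 ps by apply: map_f.
  by rewrite !mkpermK ?(allP v1) ?(allP v2).
have := @coding_gen _ (@encP m n) (m.+1 + n.+1) qs.
rewrite /= e cl u => /(_ (@encP_inj m n) (@encPM m n) (@encPV m n) (encP1 m n) isT).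
move/card_coded => c.
have e1 : [seq mkperm m e | e <- unzip1 ps] = [seq q.1 | q <- qs] by rewrite -!map_comp.
have e2 : [seq mkperm n e | e <- unzip2 ps] = [seq q.2 | q <- qs] by rewrite -!map_comp.
rewrite e1 in c1 *; rewrite e2 in c2 *; apply: isog_gen_pairs.
  exact: etrans c (etrans (esym s1) (esym c1)).
exact: etrans c (etrans (esym s2) (esym c2)).
Qed.

(** The generators in use have orders 3 and 5. The exponent 15 being odd, the second test shows that
    they are even permutations; the order then forces the whole alternating group. *)
Definition altOK (n : nat) (gs : seq raw) : bool :=
  [&& codingOK n gs, all (fun e => rpow n.+1 e 15 == iota 0 n.+1) gs
    & (size (rclos n.+1 gs)).*2 == n.+1`!].

Lemma Alt_gen n gs : altOK n.+1 gs ->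
  'Alt_('I_n.+2) = <<[set g in [seq mkperm n.+1 e | e <- gs]]>>.
Proof.
case/and3P=> ok /allP o15 /eqP sz.
have c := card_coded (coding_mkperm ok); have /and3P[/allP v _ _] := ok.
apply/eqP; rewrite eq_sym eqEcard; apply/andP; split; last first.
  have cA := @card_Alt 'I_n.+2; rewrite card_ord in cA.
  by rewrite c -leq_double sz -mul2n cA.
rewrite gen_subG; apply/subsetP=> g; rewrite inE => /mapP[e ge ->].
(* An odd power has the parity of the permutation itself. *)
rewrite Alt_even; have: odd_perm (mkperm n.+1 e ^+ 15) = false.
  rewrite (_ : _ ^+ 15 = 1) ?odd_perm1 //; apply: (@encS_inj n.+1).
  by rewrite encSX mkpermK ?v // (eqP (o15 _ ge)) encS1.
by rewrite !expgS !odd_permM expg0 odd_perm1; case: odd_perm.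
Qed.

Lemma coding_Alt n gs : altOK n.+1 gs ->
  coding ('Alt_('I_n.+2))%G (@encS n.+1) n.+2 (rclos n.+2 gs).
Proof.
move=> ok; have /and3P[cok _ _] := ok.
have := coding_mkperm cok.
by rewrite (_ : <<_>>%G = ('Alt_('I_n.+2))%G) //; apply/val_inj/esym/Alt_gen.
Qed.

Lemma coding_Sym n gs : codingOK n gs && (size (rclos n.+1 gs) == n.+1`!) ->
  coding ('Sym_('I_n.+1))%G (@encS n) n.+1 (rclos n.+1 gs).
Proof.
case/andP=> ok /eqP sz; have c := coding_mkperm ok.
suff -> : ('Sym_('I_n.+1))%G = <<[set g in [seq mkperm n e | e <- gs]]>>%G by [].
apply/val_inj/eqP; rewrite /= eq_sym eqEcard subsetT (card_coded c) sz.
by rewrite card_Sym card_ord leqnn.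
Qed.

(** * Generators and certificates *)

(* (1,2,3,4,5) and (4,5,6). *)
Definition alt6_gens : seq raw := ([:: [:: 1; 2; 3; 4; 0; 5]; [:: 0; 1; 2; 4; 5; 3]])%N.
Definition sym6_gens : seq raw := ([:: [:: 1; 0; 2; 3; 4; 5]; [:: 1; 2; 3; 4; 5; 0]])%N.

(* (1,2,3,4,5), its square, (1,2,3,4)(5,6), (1,2)(3,4), (1,2,3), (1,2,3)(4,5,6). *)
Definition alt6_s5 : raw := ([:: 1; 2; 3; 4; 0; 5])%N.
Definition alt6_s5b : raw := ([:: 2; 3; 4; 0; 1; 5])%N.
Definition alt6_s4 : raw := ([:: 1; 2; 3; 0; 5; 4])%N.
Definition alt6_s2 : raw := ([:: 1; 0; 3; 2; 4; 5])%N.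
Definition alt6_s3a : raw := ([:: 1; 2; 0; 3; 4; 5])%N.
Definition alt6_s3b : raw := ([:: 1; 2; 0; 4; 5; 3])%N.

(* The stabilizer of the point 6; [alt6_M2] below generates the transitive [A_5]
   over [alt6_s5], by images of [alt5_gens] under an isomorphism. *)
Definition alt6_M1 : seq raw := ([:: [:: 1; 2; 3; 4; 0; 5]; [:: 1; 2; 0; 3; 4; 5]])%N.
Definition alt5_gens : seq raw := ([:: [:: 1; 2; 3; 4; 0]; [:: 1; 2; 0; 3; 4]])%N.
Definition alt6_M2 : seq raw := ([:: [:: 0; 2; 5; 4; 1; 3]; [:: 1; 5; 4; 2; 3; 0]])%N.

(* All the maximal subgroups over [alt6_s4], by generators. *)
Definition alt6_s4_over : seq (seq raw) :=
  ([:: [:: [:: 4; 0; 3; 2; 5; 1]; [:: 2; 1; 5; 3; 4; 0]]; [:: [:: 5; 2; 1; 0; 3; 4]; [::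
   0; 3; 2; 5; 4; 1]]; [:: [:: 1; 3; 0; 2; 5; 4]; [:: 1; 2; 0; 3; 4; 5]]; [:: [:: 3; 5;
   1; 4; 0; 2]; [:: 0; 4; 2; 5; 1; 3]]])%N.

(* A witness [g] for a lower bound on [P(g, s)], with generators of proper
   subgroups over [s]. *)
Definition alt6_s2_low : (raw * seq (seq raw))%type :=
  (([:: 1; 2; 0; 3; 4; 5], [:: [:: [:: 4; 0; 1; 2; 3; 5]; [:: 4; 2; 1; 3; 0; 5]]; [::
   [:: 3; 5; 1; 2; 4; 0]; [:: 0; 5; 3; 2; 4; 1]]]))%N.
Definition alt6_s3a_low : (raw * seq (seq raw))%type :=
  (([:: 1; 2; 0; 3; 4; 5], [:: [:: [:: 4; 0; 1; 2; 3; 5]; [:: 4; 2; 1; 3; 0; 5]]; [::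
   [:: 5; 0; 1; 3; 2; 4]; [:: 5; 2; 1; 3; 4; 0]]]))%N.
Definition alt6_s3b_low : (raw * seq (seq raw))%type :=
  (([:: 1; 2; 0; 4; 5; 3], [:: [:: [:: 4; 5; 0; 1; 2; 3]; [:: 4; 2; 5; 0; 3; 1]]; [::
   [:: 3; 0; 5; 1; 2; 4]; [:: 4; 0; 3; 5; 1; 2]]]))%N.

(* Proper subgroups over each of the three involutions; their union is [A_6]. *)
Definition klein_low1 : seq (seq raw) :=
  ([:: [:: [:: 4; 0; 3; 5; 1; 2]; [:: 5; 0; 4; 2; 3; 1]]; [:: [:: 5; 4; 0; 1; 3; 2]; [::
   1; 5; 4; 2; 3; 0]]; [:: [:: 2; 5; 1; 4; 3; 0]; [:: 0; 1; 5; 2; 4; 3]]; [:: [:: 4; 2;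
   1; 0; 5; 3]; [:: 5; 0; 2; 3; 4; 1]]])%N.
Definition klein_low2 : seq (seq raw) :=
  ([:: [:: [:: 4; 3; 0; 5; 2; 1]; [:: 1; 4; 3; 5; 0; 2]]; [:: [:: 4; 0; 3; 2; 5; 1]; [::
   2; 1; 5; 3; 4; 0]]; [:: [:: 4; 5; 0; 1; 2; 3]; [:: 4; 2; 5; 0; 3; 1]]; [:: [:: 5; 2;
   1; 0; 3; 4]; [:: 0; 3; 2; 5; 4; 1]]])%N.
Definition klein_low3 : seq (seq raw) :=
  ([:: [:: [:: 3; 5; 1; 2; 4; 0]; [:: 0; 5; 3; 2; 4; 1]]; [:: [:: 3; 0; 5; 1; 2; 4]; [::
   4; 0; 3; 5; 1; 2]]; [:: [:: 4; 0; 1; 2; 3; 5]; [:: 4; 2; 1; 3; 0; 5]]; [:: [:: 3; 5;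
   0; 2; 1; 4]; [:: 1; 3; 5; 0; 2; 4]]; [:: [:: 5; 0; 3; 2; 1; 4]; [:: 0; 5; 1; 3; 4;
   2]]; [:: [:: 1; 0; 5; 2; 3; 4]; [:: 5; 1; 2; 0; 4; 3]]; [:: [:: 5; 2; 1; 0; 3; 4];
   [:: 5; 1; 2; 0; 4; 3]]; [:: [:: 3; 5; 1; 0; 2; 4]; [:: 0; 5; 2; 3; 1; 4]]; [:: [:: 2;
   3; 4; 5; 0; 1]; [:: 0; 1; 5; 4; 3; 2]]; [:: [:: 3; 5; 1; 4; 0; 2]; [:: 0; 4; 2; 5; 1;
   3]]])%N.
(** Only the index 0 occurs, since conjugates of the single element [alt6_s4] serve all pairs. This
    makes the result uniform. *)
Definition alt6_certs : seq (raw * seq (nat * raw))%type :=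
  ([:: ([:: 1; 2; 3; 4; 0; 5], [:: (0, [:: 0; 1; 2; 3; 4; 5]); (0, [:: 2; 4; 5; 0; 1;
   3]); (0, [:: 4; 1; 5; 2; 3; 0]); (0, [:: 1; 3; 4; 2; 0; 5]); (0, [:: 0; 1; 3; 4; 2;
   5])]); ([:: 2; 3; 4; 0; 1; 5], [:: (0, [:: 0; 1; 2; 3; 4; 5]); (0, [:: 2; 4; 5; 0; 1;
   3]); (0, [:: 4; 1; 5; 2; 3; 0]); (0, [:: 1; 3; 4; 2; 0; 5]); (0, [:: 0; 1; 3; 4; 2;
   5])]); ([:: 1; 2; 3; 0; 5; 4], [:: (0, [:: 2; 3; 4; 0; 1; 5]); (0, [:: 3; 4; 0; 2; 5;
   1]); (0, [:: 3; 4; 0; 5; 1; 2]); (0, [:: 1; 3; 5; 4; 0; 2]); (0, [:: 4; 1; 5; 2; 3;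
   0]); (0, [:: 5; 1; 3; 2; 4; 0])]); ([:: 1; 0; 3; 2; 4; 5], [:: (0, [:: 1; 2; 3; 4; 0;
   5]); (0, [:: 1; 5; 2; 3; 4; 0]); (0, [:: 1; 2; 4; 0; 3; 5]); (0, [:: 0; 1; 2; 4; 5;
   3]); (0, [:: 2; 3; 4; 1; 5; 0]); (0, [:: 5; 1; 3; 2; 4; 0])]); ([:: 1; 2; 0; 3; 4;
   5], [:: (0, [:: 2; 3; 4; 0; 1; 5]); (0, [:: 3; 4; 0; 2; 5; 1]); (0, [:: 4; 0; 1; 2;
   3; 5]); (0, [:: 4; 5; 3; 0; 2; 1]); (0, [:: 2; 4; 5; 1; 3; 0]); (0, [:: 1; 2; 4; 3;
   5; 0])]); ([:: 1; 2; 0; 4; 5; 3], [:: (0, [:: 0; 1; 2; 3; 4; 5]); (0, [:: 2; 4; 5; 0;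
   1; 3]); (0, [:: 4; 1; 5; 2; 3; 0]); (0, [:: 3; 4; 0; 2; 5; 1]); (0, [:: 0; 1; 2; 4;
   5; 3]); (0, [:: 5; 0; 1; 4; 3; 2])])])%N.

(* Elements of the two classes of order 6 and of the class of order 5, each with
   the maximal subgroups over it not containing [A_6]. *)
Definition sym6_mates : seq (raw * seq (seq raw))%type :=
  ([:: ([:: 1; 2; 3; 4; 5; 0], [:: [:: [:: 2; 3; 4; 5; 0; 1]; [:: 5; 2; 4; 0; 3; 1]];
   [:: [:: 0; 5; 4; 1; 2; 3]; [:: 3; 2; 1; 4; 5; 0]]; [:: [:: 1; 3; 5; 4; 0; 2]; [:: 3;
   5; 4; 0; 2; 1]]]); ([:: 1; 2; 0; 4; 3; 5], [:: [:: [:: 0; 1; 2; 4; 3; 5]; [:: 1; 4;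
   0; 2; 3; 5]]; [:: [:: 0; 2; 1; 5; 3; 4]; [:: 3; 5; 4; 2; 0; 1]]; [:: [:: 2; 1; 5; 4;
   3; 0]; [:: 5; 2; 0; 3; 4; 1]]]); ([:: 1; 2; 3; 4; 0; 5], [:: [:: [:: 4; 0; 3; 5; 1;
   2]; [:: 3; 0; 1; 5; 2; 4]]; [:: [:: 0; 1; 2; 4; 3; 5]; [:: 1; 4; 0; 2; 3; 5]]])])%N.
Definition sym6_certs : seq (raw * seq (nat * raw))%type :=
  ([:: ([:: 1; 2; 3; 4; 5; 0], [:: (0, [:: 1; 0; 2; 3; 4; 5]); (1, [:: 0; 1; 2; 3; 4;
   5]); (2, [:: 4; 5; 1; 0; 2; 3]); (2, [:: 5; 4; 0; 1; 2; 3]); (2, [:: 3; 4; 5; 0; 1;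
   2]); (2, [:: 3; 2; 4; 5; 0; 1])]); ([:: 1; 2; 0; 4; 3; 5], [:: (0, [:: 0; 1; 2; 3; 4;
   5]); (1, [:: 1; 2; 3; 4; 5; 0]); (2, [:: 5; 4; 1; 0; 2; 3]); (2, [:: 4; 5; 1; 0; 2;
   3]); (1, [:: 1; 2; 3; 5; 0; 4]); (0, [:: 2; 3; 0; 4; 1; 5])]); ([:: 1; 2; 3; 4; 0;
   5], [:: (0, [:: 0; 1; 2; 3; 4; 5]); (1, [:: 1; 2; 3; 4; 5; 0]); (1, [:: 5; 0; 1; 3;
   2; 4]); (0, [:: 1; 4; 0; 2; 3; 5]); (1, [:: 5; 1; 3; 2; 4; 0]); (0, [:: 3; 5; 1; 0;
   2; 4]); (2, [:: 0; 3; 4; 5; 1; 2])]); ([:: 1; 0; 2; 3; 4; 5], [:: (0, [:: 0; 1; 2; 3;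
   4; 5]); (2, [:: 4; 5; 0; 1; 3; 2]); (2, [:: 5; 4; 0; 2; 1; 3]); (0, [:: 2; 3; 5; 1;
   4; 0]); (2, [:: 3; 5; 0; 1; 2; 4]); (2, [:: 5; 4; 0; 1; 2; 3]); (0, [:: 2; 3; 4; 5;
   1; 0]); (0, [:: 4; 5; 1; 2; 0; 3]); (2, [:: 4; 5; 1; 0; 2; 3])]); ([:: 1; 0; 3; 2; 4;
   5], [:: (0, [:: 0; 2; 3; 4; 5; 1]); (1, [:: 2; 3; 4; 5; 0; 1]); (1, [:: 5; 1; 3; 2;
   4; 0]); (0, [:: 1; 2; 0; 3; 4; 5]); (1, [:: 3; 1; 2; 5; 4; 0]); (0, [:: 5; 3; 1; 0;
   2; 4]); (2, [:: 1; 3; 4; 5; 0; 2])]); ([:: 1; 0; 3; 2; 5; 4], [:: (1, [:: 0; 1; 2; 3;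
   4; 5]); (2, [:: 3; 4; 5; 1; 0; 2]); (2, [:: 3; 5; 1; 0; 2; 4]); (1, [:: 1; 2; 3; 5;
   4; 0]); (2, [:: 0; 2; 3; 4; 5; 1]); (2, [:: 0; 3; 4; 5; 1; 2]); (1, [:: 2; 3; 4; 5;
   0; 1]); (1, [:: 4; 5; 0; 1; 2; 3]); (2, [:: 5; 3; 0; 1; 2; 4])]); ([:: 1; 2; 0; 3; 4;
   5], [:: (0, [:: 0; 1; 2; 3; 4; 5]); (1, [:: 2; 4; 5; 0; 1; 3]); (2, [:: 5; 4; 0; 2;
   1; 3]); (2, [:: 4; 5; 0; 1; 3; 2]); (2, [:: 2; 4; 5; 0; 1; 3]); (0, [:: 2; 3; 4; 5;
   1; 0]); (1, [:: 4; 5; 0; 1; 2; 3])]); ([:: 1; 2; 0; 4; 5; 3], [:: (0, [:: 2; 0; 3; 4;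
   5; 1]); (1, [:: 1; 2; 3; 4; 5; 0]); (2, [:: 3; 5; 1; 0; 2; 4]); (1, [:: 3; 2; 4; 5;
   0; 1]); (2, [:: 2; 1; 3; 4; 5; 0]); (0, [:: 3; 1; 0; 2; 4; 5]); (0, [:: 4; 5; 1; 2;
   0; 3])]); ([:: 1; 2; 3; 0; 4; 5], [:: (0, [:: 0; 1; 2; 3; 4; 5]); (1, [:: 2; 3; 4; 5;
   0; 1]); (1, [:: 3; 4; 5; 0; 1; 2]); (0, [:: 4; 3; 5; 1; 0; 2]); (0, [:: 3; 1; 0; 2;
   4; 5]); (1, [:: 4; 5; 0; 1; 2; 3]); (2, [:: 3; 5; 0; 1; 2; 4])]); ([:: 1; 2; 3; 0; 5;
   4], [:: (0, [:: 1; 0; 2; 3; 4; 5]); (1, [:: 0; 1; 2; 3; 4; 5]); (2, [:: 4; 5; 1; 0;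
   2; 3]); (2, [:: 5; 4; 0; 1; 2; 3]); (2, [:: 3; 4; 5; 0; 1; 2]); (2, [:: 3; 2; 4; 5;
   0; 1])])])%N.

(* Elements [x] and [y] with subgroups not containing [A_6], the first ones over
   [x] and the other ones over [y], that together contain every element of [A_6]. *)
Definition sym6_neg_even : (raw * raw * seq (seq raw) * seq (seq raw))%type :=
  (([:: 1; 0; 2; 3; 4; 5], [:: 0; 1; 2; 3; 5; 4], [:: [:: [:: 0; 1; 2; 4; 3; 5]; [:: 1;
   4; 0; 2; 3; 5]]; [:: [:: 0; 1; 3; 2; 4; 5]; [:: 3; 5; 1; 2; 4; 0]]; [:: [:: 1; 0; 4;
   2; 3; 5]; [:: 4; 3; 1; 5; 0; 2]]; [:: [:: 4; 0; 2; 5; 1; 3]; [:: 2; 3; 4; 1; 5; 0]]],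
   [:: [:: [:: 5; 1; 2; 3; 4; 0]; [:: 5; 3; 2; 0; 1; 4]]; [:: [:: 0; 1; 2; 3; 5; 4]; [::
   2; 1; 5; 0; 3; 4]]; [:: [:: 0; 1; 2; 3; 5; 4]; [:: 0; 2; 5; 1; 3; 4]]; [:: [:: 0; 2;
   1; 3; 4; 5]; [:: 4; 0; 1; 3; 5; 2]]; [:: [:: 0; 2; 1; 5; 3; 4]; [:: 3; 5; 4; 2; 0;
   1]]; [:: [:: 5; 3; 1; 2; 4; 0]; [:: 2; 0; 4; 5; 1; 3]]; [:: [:: 3; 0; 5; 1; 4; 2];
   [:: 2; 4; 1; 5; 0; 3]]; [:: [:: 3; 5; 0; 2; 4; 1]; [:: 1; 2; 4; 5; 0; 3]]; [:: [:: 1;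
   0; 4; 5; 3; 2]; [:: 2; 3; 0; 1; 5; 4]]; [:: [:: 3; 4; 5; 0; 2; 1]; [:: 1; 0; 3; 2; 5;
   4]]; [:: [:: 2; 4; 0; 5; 3; 1]; [:: 1; 0; 3; 2; 5; 4]]; [:: [:: 0; 4; 3; 2; 5; 1];
   [:: 1; 5; 2; 3; 0; 4]]; [:: [:: 1; 0; 3; 5; 4; 2]; [:: 0; 1; 4; 2; 5; 3]]]))%N.

(* The same for every odd class of [S_6], given by a representative. *)
Definition sym6_neg_odd : seq (raw * (raw * raw * seq (seq raw) * seq (seq raw)))%type :=
  ([:: ([:: 1; 0; 2; 3; 4; 5], ([:: 1; 2; 3; 4; 5; 0], [:: 1; 0; 2; 3; 4; 5], [::], [::
   [:: [:: 5; 1; 2; 3; 4; 0]; [:: 5; 3; 2; 0; 1; 4]]; [:: [:: 0; 1; 2; 4; 3; 5]; [:: 1;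
   4; 0; 2; 3; 5]]; [:: [:: 3; 4; 5; 1; 0; 2]; [:: 5; 2; 1; 4; 3; 0]]])); ([:: 1; 2; 3;
   4; 5; 0], ([:: 1; 2; 3; 4; 5; 0], [:: 3; 4; 5; 0; 1; 2], [::], [:: [:: [:: 5; 3; 0;
   4; 1; 2]; [:: 4; 5; 0; 2; 1; 3]]; [:: [:: 3; 5; 1; 4; 0; 2]; [:: 5; 4; 1; 2; 0; 3]];
   [:: [:: 4; 0; 3; 5; 1; 2]; [:: 3; 0; 1; 5; 2; 4]]; [:: [:: 2; 3; 4; 5; 0; 1]; [:: 5;
   2; 4; 0; 3; 1]]; [:: [:: 3; 0; 5; 4; 1; 2]; [:: 5; 3; 4; 1; 2; 0]]; [:: [:: 5; 4; 3;
   0; 1; 2]; [:: 2; 3; 0; 1; 5; 4]]; [:: [:: 3; 2; 5; 0; 1; 4]; [:: 2; 5; 0; 4; 3; 1]];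
   [:: [:: 3; 4; 5; 0; 2; 1]; [:: 1; 0; 3; 2; 5; 4]]; [:: [:: 3; 4; 5; 1; 0; 2]; [:: 5;
   2; 1; 4; 3; 0]]; [:: [:: 3; 4; 0; 5; 1; 2]; [:: 1; 0; 3; 2; 5; 4]]; [:: [:: 0; 2; 1;
   5; 3; 4]; [:: 3; 5; 4; 2; 0; 1]]; [:: [:: 1; 0; 4; 2; 3; 5]; [:: 4; 3; 1; 5; 0; 2]];
   [:: [:: 5; 3; 1; 2; 4; 0]; [:: 2; 0; 4; 5; 1; 3]]; [:: [:: 0; 5; 4; 1; 2; 3]; [:: 3;
   2; 1; 4; 5; 0]]])); ([:: 1; 0; 3; 2; 5; 4], ([:: 1; 2; 3; 4; 5; 0], [:: 1; 0; 2; 3;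
   4; 5], [:: [:: [:: 2; 3; 4; 5; 0; 1]; [:: 5; 2; 4; 0; 3; 1]]], [:: [:: [:: 5; 3; 4;
   0; 2; 1]; [:: 1; 0; 3; 2; 5; 4]]; [:: [:: 3; 4; 5; 1; 0; 2]; [:: 5; 2; 1; 4; 3;
   0]]])); ([:: 1; 2; 3; 0; 4; 5], ([:: 1; 2; 3; 4; 5; 0], [:: 1; 0; 2; 3; 4; 5], [::],
   [:: [:: [:: 5; 1; 2; 3; 4; 0]; [:: 5; 3; 2; 0; 1; 4]]; [:: [:: 0; 1; 2; 4; 3; 5]; [::
   1; 4; 0; 2; 3; 5]]; [:: [:: 0; 1; 3; 2; 4; 5]; [:: 3; 5; 1; 2; 4; 0]]; [:: [:: 0; 2;
   1; 3; 4; 5]; [:: 4; 0; 1; 3; 5; 2]]; [:: [:: 1; 0; 3; 5; 4; 2]; [:: 0; 1; 4; 2; 5;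
   3]]])); ([:: 1; 2; 0; 4; 3; 5], ([:: 1; 2; 3; 4; 5; 0], [:: 1; 0; 2; 3; 4; 5], [::],
   [:: [:: [:: 5; 1; 2; 3; 4; 0]; [:: 5; 3; 2; 0; 1; 4]]; [:: [:: 0; 1; 2; 4; 3; 5]; [::
   1; 4; 0; 2; 3; 5]]; [:: [:: 0; 1; 3; 2; 4; 5]; [:: 3; 5; 1; 2; 4; 0]]; [:: [:: 0; 2;
   1; 3; 4; 5]; [:: 4; 0; 1; 3; 5; 2]]; [:: [:: 1; 4; 5; 3; 0; 2]; [:: 3; 0; 2; 4; 1;
   5]]; [:: [:: 1; 4; 2; 5; 0; 3]; [:: 2; 0; 4; 3; 1; 5]]; [:: [:: 1; 3; 2; 0; 5; 4];
   [:: 2; 0; 3; 1; 4; 5]]; [:: [:: 3; 1; 4; 5; 2; 0]; [:: 5; 3; 2; 0; 4; 1]]; [:: [:: 2;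
   1; 5; 4; 3; 0]; [:: 5; 2; 0; 3; 4; 1]]; [:: [:: 0; 4; 3; 2; 5; 1]; [:: 1; 5; 2; 3; 0;
   4]]; [:: [:: 0; 2; 1; 5; 3; 4]; [:: 3; 5; 4; 2; 0; 1]]; [:: [:: 1; 0; 4; 2; 3; 5];
   [:: 4; 3; 1; 5; 0; 2]]; [:: [:: 3; 0; 5; 1; 4; 2]; [:: 2; 4; 1; 5; 0; 3]]; [:: [:: 4;
   0; 2; 5; 1; 3]; [:: 2; 3; 4; 1; 5; 0]]]))])%N.

(* Images of [alt6_gens] under an isomorphism of [A_6] with [PSL(2,9)] acting on
   the projective line over [F_9], whose points are numbered 0 (the point at
   infinity) to 9. *)
Definition psl29_gens : seq raw :=
  ([:: [:: 1; 6; 5; 7; 9; 8; 4; 2; 3; 0]; [:: 0; 7; 8; 9; 1; 2; 3; 4; 5; 6]])%N.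
(** An involution without fixed points, outside [PSL(2,9)]; it also witnesses that the extension
    splits. *)
Definition pgl29_outer : raw := ([:: 1; 0; 9; 5; 6; 3; 4; 8; 7; 2])%N.

(* One element of each class of elements of order 10, both in [pgl29_M]. *)
Definition pgl29_special : seq raw :=
  ([:: [:: 1; 6; 3; 4; 8; 7; 2; 0; 9; 5]; [:: 2; 3; 8; 9; 5; 1; 4; 6; 7; 0]])%N.
(** The dihedral group of order 20 that normalizes a cyclic group of order 10. *)
Definition pgl29_M : seq raw :=
  ([:: [:: 0; 7; 9; 8; 4; 6; 5; 1; 3; 2]; [:: 2; 3; 8; 9; 5; 1; 4; 6; 7; 0]])%N.
Definition pgl29_lows : seq (raw * (raw * seq (seq raw)))%type :=
  ([:: ([:: 0; 4; 5; 6; 7; 8; 9; 1; 2; 3], ([:: 0; 4; 5; 6; 7; 8; 9; 1; 2; 3], [:: [::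
   [:: 6; 2; 8; 4; 1; 7; 5; 9; 3; 0]; [:: 5; 6; 1; 7; 4; 3; 9; 0; 8; 2]]])); ([:: 0; 1;
   8; 6; 5; 3; 7; 9; 4; 2], ([:: 0; 1; 8; 6; 5; 3; 7; 9; 4; 2], [:: [:: [:: 6; 1; 2; 9;
   7; 8; 3; 5; 4; 0]; [:: 6; 1; 8; 0; 3; 5; 2; 4; 9; 7]]])); ([:: 1; 0; 2; 3; 7; 6; 5;
   4; 9; 8], ([:: 0; 4; 5; 6; 7; 8; 9; 1; 2; 3], [:: [:: [:: 6; 2; 8; 4; 1; 7; 5; 9; 3;
   0]; [:: 5; 6; 1; 7; 4; 3; 9; 0; 8; 2]]])); ([:: 1; 2; 3; 0; 6; 5; 7; 9; 8; 4], ([::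
   0; 4; 5; 6; 7; 8; 9; 1; 2; 3], [:: [:: [:: 6; 2; 8; 4; 1; 7; 5; 9; 3; 0]; [:: 5; 6;
   1; 7; 4; 3; 9; 0; 8; 2]]])); ([:: 1; 0; 9; 5; 6; 3; 4; 8; 7; 2], ([:: 1; 0; 9; 5; 6;
   3; 4; 8; 7; 2], [:: [:: [:: 0; 3; 2; 1; 9; 8; 7; 6; 5; 4]; [:: 7; 4; 8; 5; 6; 2; 0;
   9; 1; 3]]])); ([:: 1; 6; 5; 7; 9; 8; 4; 2; 3; 0], ([:: 0; 4; 5; 6; 7; 8; 9; 1; 2; 3],
   [:: [:: [:: 6; 2; 8; 4; 1; 7; 5; 9; 3; 0]; [:: 5; 6; 1; 7; 4; 3; 9; 0; 8; 2]]]));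
   ([:: 1; 9; 7; 3; 5; 2; 4; 0; 8; 6], ([:: 0; 1; 8; 6; 5; 3; 7; 9; 4; 2], [:: [:: [::
   1; 7; 5; 6; 0; 3; 2; 4; 8; 9]; [:: 1; 9; 7; 3; 5; 2; 4; 0; 8; 6]]])); ([:: 1; 9; 8;
   4; 2; 3; 0; 6; 5; 7], ([:: 0; 4; 5; 6; 7; 8; 9; 1; 2; 3], [:: [:: [:: 6; 2; 8; 4; 1;
   7; 5; 9; 3; 0]; [:: 5; 6; 1; 7; 4; 3; 9; 0; 8; 2]]]))])%N.
(** Two 4-cycles fixing the points 0 and 1. It cannot be an involution, as the extension does not
    split. *)
Definition m10_outer : raw := ([:: 0; 1; 6; 8; 5; 7; 3; 9; 2; 4])%N.

(* One element of each class of elements of order 8, both in [m10_M]. *)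
Definition m10_special : seq raw :=
  ([:: [:: 1; 0; 6; 8; 9; 3; 7; 5; 4; 2]; [:: 1; 0; 8; 6; 5; 2; 4; 9; 7; 3]])%N.
(** A Sylow 2-subgroup, semidihedral of order 16. *)
Definition m10_M : seq raw :=
  ([:: [:: 1; 0; 7; 4; 3; 5; 8; 2; 6; 9]; [:: 1; 0; 5; 9; 6; 4; 3; 8; 2; 7]])%N.
Definition m10_lows : seq (raw * (raw * seq (seq raw)))%type :=
  ([:: ([:: 0; 4; 5; 6; 7; 8; 9; 1; 2; 3], ([:: 0; 4; 5; 6; 7; 8; 9; 1; 2; 3], [:: [::
   [:: 1; 7; 5; 6; 0; 3; 2; 4; 8; 9]; [:: 4; 8; 1; 9; 2; 7; 3; 6; 0; 5]]])); ([:: 0; 1;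
   4; 7; 3; 6; 9; 2; 5; 8], ([:: 0; 4; 5; 6; 7; 8; 9; 1; 2; 3], [:: [:: [:: 1; 7; 5; 6;
   0; 3; 2; 4; 8; 9]; [:: 4; 8; 1; 9; 2; 7; 3; 6; 0; 5]]])); ([:: 1; 0; 2; 3; 7; 6; 5;
   4; 9; 8], ([:: 0; 4; 5; 6; 7; 8; 9; 1; 2; 3], [:: [:: [:: 1; 7; 5; 6; 0; 3; 2; 4; 8;
   9]; [:: 4; 8; 1; 9; 2; 7; 3; 6; 0; 5]]])); ([:: 0; 1; 6; 8; 5; 7; 3; 9; 2; 4], ([::
   0; 1; 4; 7; 3; 6; 9; 2; 5; 8], [:: [:: [:: 9; 1; 6; 2; 4; 3; 5; 8; 0; 7]; [:: 4; 1;
   2; 5; 3; 0; 8; 6; 9; 7]]])); ([:: 1; 6; 5; 7; 9; 8; 4; 2; 3; 0], ([:: 0; 4; 5; 6; 7;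
   8; 9; 1; 2; 3], [:: [:: [:: 1; 7; 5; 6; 0; 3; 2; 4; 8; 9]; [:: 4; 8; 1; 9; 2; 7; 3;
   6; 0; 5]]]))])%N.
Definition alt6_els := Eval vm_compute in rclos 6 alt6_gens.
Definition sym6_els := Eval vm_compute in rclos 6 sym6_gens.
Definition pgl29_gens := rcons psl29_gens pgl29_outer.
Definition m10_gens := rcons psl29_gens m10_outer.
Definition psl29_els := Eval vm_compute in rclos 10 psl29_gens.
Definition pgl29_els := Eval vm_compute in rclos 10 pgl29_gens.
Definition m10_els := Eval vm_compute in rclos 10 m10_gens.

Lemma coding_Sym6 : coding Sym6 (@encS 5) 6 sym6_els.
Proof.
have -> : sym6_els = rclos 6 sym6_gens by vm_compute.
by apply: coding_Sym; vm_compute.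
Qed.

Lemma coding_Alt6 : coding Alt6 (@encS 5) 6 alt6_els.
Proof.
have -> : alt6_els = rclos 6 alt6_gens by vm_compute.
by apply: coding_Alt; vm_compute.
Qed.

(** * Values of sigma and P from coded data *)

Section Extrema.

Variables (T : finType) (A : {set T}) (f : T -> rat).

Lemma max_over_eq m x : x \in A -> f x = m ->
  (forall y, y \in A -> (f y <= m)%O) -> max_over A f = m.
Proof.
move=> Ax fx mf; have A0 : A != set0 by apply/set0Pn; exists x.
by apply/max_overP => //; split=> //; exists x.
Qed.

Lemma max_over_ge x : x \in A -> (f x <= max_over A f)%O.
Proof.
move=> Ax; have A0 : A != set0 by apply/set0Pn; exists x.
by have [/(_ erefl)[_ ->]] := max_overP f (max_over A f) A0.
Qed.

Lemma min_over_eq m x : x \in A -> f x = m ->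
  (forall y, y \in A -> (m <= f y)%O) -> min_over A f = m.
Proof.
move=> Ax fx mf; have A0 : A != set0 by apply/set0Pn; exists x.
by apply/min_overP => //; split=> //; exists x.
Qed.

Lemma eq_max_over (h : T -> rat) : {in A, f =1 h} -> max_over A f = max_over A h.
Proof.
move=> fh; case: (set_0Vmem A) => [->|[x Ax]].
  by rewrite /max_over; case: pickP => // x; rewrite inE.
have A0 : A != set0 by apply/set0Pn; exists x.
have [/(_ erefl)[[y Ay hy] mh] _] := max_overP h (max_over A h) A0.
by apply: (max_over_eq Ay) => [|z Az]; rewrite fh //; exact: mh.
Qed.

End Extrema.

Section Values.

Variables (gT : finGroupType) (G : {group gT}).
Implicit Types (s g x : gT).

Lemma sigma_atJ s x : x \in G -> sigma_at G (s ^ x) = sigma_at G s.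
Proof. by move=> Gx; apply: eq_max_over => g _; exact: sigma_eltJ. Qed.

Lemma nongen_atJ s x : s \in G -> x \in G -> nongen_at G (s ^ x) = nongen_at G s.
Proof.
move=> Gs Gx; apply: eq_max_over => g /setD1P[_ Gg].
by rewrite !nongen_elt_count ?groupJ // nongen_countJ.
Qed.

Lemma frac_eq (a b c d : nat) : 0 < b -> 0 < d -> (a * d == c * b)%N ->
  (a%:R / b%:R = c%:R / d%:R :> rat)%R.
Proof.
move=> b0 d0 /eqP e; apply/eqP.
by rewrite GRing.eqr_div ?(Num.Theory.pnatr_eq0 rat) -?lt0n // -!GRing.natrM e.
Qed.

Lemma ler_fracE (a b d : nat) : 0 < d ->
  (a%:R / d%:R <= b%:R / d%:R :> rat)%R = (a <= b).
Proof.
by move=> d0; rewrite Num.Theory.ler_pM2r ?Num.Theory.ler_nat // Num.Theory.invr_gt0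
  Num.Theory.ltr0n.
Qed.

Lemma ler_frac (a b d : nat) : a <= b -> (a%:R / d%:R <= b%:R / d%:R :> rat)%R.
Proof.
by move=> ab; rewrite Num.Theory.ler_wpM2r ?Num.Theory.invr_ge0 ?Num.Theory.ler0n
  ?Num.Theory.ler_nat.
Qed.

Lemma sigma_at_ge g s k : g \in G^# ->
    k <= \sum_(M in maximals_containing G s) fusion_count G M g ->
  (k%:R / #|G|%:R <= sigma_at G s)%R.
Proof.
move=> Gg kN; apply: Order.POrderTheory.le_trans (max_over_ge _ Gg).
by rewrite sigma_elt_fusion; exact: ler_frac.
Qed.

Lemma nongen_at_ge g s k : g \in G^# -> s \in G -> k <= nongen_count G g s ->
  (k%:R / #|G|%:R <= nongen_at G s)%R.
Proof.
move=> G'g Gs kN; apply: Order.POrderTheory.le_trans (max_over_ge _ G'g).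
by rewrite nongen_elt_count //; [exact: ler_frac | case/setD1P: G'g].
Qed.

End Values.

Section CodedValues.

Variables (gT : finGroupType) (G : {group gT}) (enc : gT -> raw) (n : nat).
Variables (els gens reps : seq raw).
Hypotheses (cG : coding G enc n els) (repG : repcover n els gens reps).

Local Notation gen_of := (gen_of G enc).
Local Notation dec := (dec G enc).

Lemma reps_els r : r \in reps -> r \in els.
Proof. by case/and3P: repG => _ /allP/(_ r). Qed.

Lemma dec_reps r : r \in reps -> dec r \in G.
Proof. by move/reps_els/(decG cG). Qed.

Lemma dec_ntriv r : r \in els -> r != iota 0 n -> dec r \in G^#.
Proof.
by move=> rr r1; rewrite !inE (decG cG rr) -(enc_eq1 cG) ?(decG cG) // (decK cG) // r1.
Qed.

Lemma sigma_at_exact s k (N : raw -> nat) :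
    (forall g, g \in G ->
       \sum_(M in maximals_containing G s) fusion_count G M g = N (enc g)) ->
    all (fun r => N r <= k) reps && has (fun r => (r != iota 0 n) && (N r == k)) reps ->
  sigma_at G s = (k%:R / #|G|%:R)%R.
Proof.
move=> eN /andP[/allP leN /hasP[r rr /andP[r1 /eqP eNr]]].
have [G'r rE] := (dec_ntriv (reps_els rr) r1, decK cG (reps_els rr)).
apply: max_over_eq G'r _ _.
  by rewrite sigma_elt_fusion eN ?rE ?eNr // dec_reps.
move=> g /(repcoverP cG repG)[r' [y [rr' _ Gy ->]]].
rewrite sigma_elt_class // sigma_elt_fusion eN ?dec_reps //.
by apply: ler_frac; rewrite (decK cG) ?leN ?reps_els.
Qed.

Lemma nongen_at_exact s k gss : s \in G ->
    lowOK n els els gss (enc s) ->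
    gen_off n els els (tries n gss) (enc s) ->
    (let ts := tries n gss in all (fun r => lowcount els ts r <= k) reps &&
      has (fun r => (r != iota 0 n) && (lowcount els ts r == k)) reps) ->
  nongen_at G s = (k%:R / #|G|%:R)%R.
Proof.
move=> Gs low off /= /andP[/allP leN /hasP[r rr /andP[r1 /eqP eNr]]].
have [G'r rE] := (dec_ntriv (reps_els rr) r1, decK cG (reps_els rr)).
apply: max_over_eq G'r _ _.
  by rewrite nongen_elt_count ?(lowcount_eq cG _ _ low) ?rE ?eNr ?dec_reps.
move=> g /(repcoverP cG repG)[r' [y [rr' _ Gy ->]]].
rewrite nongen_elt_count ?groupJ ?dec_reps // nongen_count_class //.
rewrite (lowcount_eq cG _ _ low) ?dec_reps // (decK cG) ?reps_els //.
exact/ler_frac/leN.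
Qed.

Lemma sigma_at_pair s k gs1 gs2 : s \in G ->
    maxpairOK n els els gs1 gs2 (enc s) ->
    (let t1 := tof (rclos n gs1) in let t2 := tof (rclos n gs2) in
     let N r := (fcount els t1 r + fcount els t2 r)%N in
     [&& has (fun e => tmem t1 e && ~~ tmem t2 e) els, all (fun r => N r <= k) reps
       & has (fun r => (r != iota 0 n) && (N r == k)) reps]) ->
  sigma_at G s = (k%:R / #|G|%:R)%R.
Proof.
move=> Gs ok /= /and3P[/hasP[e eels /andP[e1 e2]] Nle Neq].
have /and3P[/andP[/and3P[ok1 ok2 _] _] _ _] := ok.
apply: (sigma_at_exact (N := fun r => fcount els (tof (rclos n gs1)) r +
                                      fcount els (tof (rclos n gs2)) r)); last first.
  by rewrite Nle.
(* The first count in the certificate shows that the two subgroups differ, so the sum over the set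
   really has two terms. *)
move=> g Gg; rewrite (maxpairP cG Gs ok) big_setU1 ?big_set1 /=; last first.
  rewrite inE; apply/eqP=> eM; move: e1.
  rewrite -(decK cG eels) -(mem_gen_of cG ok1) ?(decG cG) // eM.
  by rewrite (mem_gen_of cG ok2) ?(decG cG) // (decK cG eels) (negPf e2).
by rewrite (fusion_count_gen_of cG ok1) // (fusion_count_gen_of cG ok2).
Qed.

Lemma sigma_at_single s k gs1 : s \in G ->
    maxpairOK n els els gs1 gs1 (enc s) ->
    (let t1 := tof (rclos n gs1) in let N r := fcount els t1 r in
     all (fun r => N r <= k) reps && has (fun r => (r != iota 0 n) && (N r == k)) reps) ->
  sigma_at G s = (k%:R / #|G|%:R)%R.
Proof.
move=> Gs ok /= Nok; have /and3P[/andP[/and3P[ok1 _ _] _] _ _] := ok.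
apply: (sigma_at_exact (N := fcount els (tof (rclos n gs1)))) Nok => g Gg.
by rewrite (maxpairP cG Gs ok) setUid big_set1 (fusion_count_gen_of cG ok1).
Qed.

Lemma nongen_at_low s k p : s \in G ->
    lowOK n els els p.2 (enc s) ->
    [&& p.1 \in els, p.1 != iota 0 n & k <= lowcount els (tries n p.2) p.1] ->
  (k%:R / #|G|%:R <= nongen_at G s)%R.
Proof.
move=> Gs low /and3P[pels p1 kle]; apply: (nongen_at_ge (dec_ntriv pels p1) Gs).
apply: leq_trans kle _; rewrite -{1}(decK cG pels).
exact: (lowcount_le cG (decG cG pels) Gs low).
Qed.

Lemma sigma_at_low s k p : s \in G ->
    lowOK n els els p.2 (enc s) ->
    [&& p.1 \in els, p.1 != iota 0 n & k <= lowcount els (tries n p.2) p.1] ->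
  (k%:R / #|G|%:R <= sigma_at G s)%R.
Proof.
move=> Gs low /and3P[pels p1 kle]; apply: (sigma_at_ge (dec_ntriv pels p1)).
apply: leq_trans (nongen_le_sigma (decG cG pels) Gs).
apply: leq_trans kle _; rewrite -{1}(decK cG pels).
exact: (lowcount_le cG (decG cG pels) Gs low).
Qed.

(** Checks that the listed subgroups over [s] are maximal and pairwise distinct, but not that the
    list is complete; for a lower bound on sigma this suffices. *)
Definition maxlistOK (m : nat) (l : seq raw) (gss : seq (seq raw)) (s : raw) : bool :=
  lowOK m l l gss s &&
  all (fun gs => let t := tof (rclos m gs) in
         gen_all m l gs [seq e <- l | ~~ tmem t e] tnil) gss &&
  pairwise (fun gs1 gs2 => let t := tof (rclos m gs2) in
              has (fun e => ~~ tmem t e) (rclos m gs1)) gss.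

Lemma maxlistP gss s : s \in G -> maxlistOK n els gss (enc s) ->
  uniq [seq gen_of gs | gs <- gss] /\
  {subset [seq gen_of gs | gs <- gss] <= maximals_containing G s}.
Proof.
move=> Gs /andP[/andP[/andP[/allP ok sM] /allP gen] pw].
rewrite all_map in sM; have {sM} /allP sM := sM.
have sgs gs : gs \in gss -> {subset gs <= els}.
  by move=> /ok/and3P[/allP].
split.
  rewrite uniq_pairwise pairwise_map; apply: (sub_in_pairwise (P := mem gss)) pw; last exact/allP.
  move=> gs1 gs2 gss1 gss2 /hasP[e]; rewrite -{1}(map_enc_dec cG (sgs _ gss1)).
  case/(rclos_sound (codM cG) (cod1 cG) (sub_dec cG (sgs _ gss1))) => x xM1 ->.
  rewrite -(mem_gen_of cG (ok _ gss2)).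
    by apply: contraNneq => <-.
  exact: (subsetP (gen_of_subG cG (ok _ gss1))).
move=> _ /mapP[gs gss_gs ->]; have okgs := ok _ gss_gs.
have sgsM : s \in gen_of gs by rewrite (mem_gen_of cG okgs) //; exact: sM.
rewrite inE sgsM andbT.
apply/maxgroupP.
rewrite properE (gen_of_subG cG okgs) (gen_of_notT cG cG (subxx G) okgs); split=> // K.
case/andP=> sKG nGK sMK; apply/eqP; rewrite eqEsubset sMK andbT.
apply/subsetP=> x Kx; apply: contraR nGK => nMx; have Gx := subsetP sKG _ Kx.
set todo := [seq e <- els | ~~ tmem (tof (rclos n gs)) e].
have stodo : {subset todo <= els} by move=> e; rewrite mem_filter => /andP[].
have /(_ _ Gx) := gen_allP cG cG (subxx G) (sgs _ gss_gs) stodo (gen _ gss_gs).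
rewrite mem_filter -(mem_gen_of cG okgs) // nMx (mem_enc cG Gx) => /(_ isT)/subset_trans.
apply; rewrite gen_subG subUset sub1set Kx /=.
by apply: subset_trans sMK; exact: subset_gen.
Qed.

Lemma sigma_at_maxlist s k gss g : s \in G -> maxlistOK n els gss (enc s) ->
    [&& g \in els, g != iota 0 n &
     k <= \sum_(gs <- gss) fcount els (tof (rclos n gs)) g] ->
  (k%:R / #|G|%:R <= sigma_at G s)%R.
Proof.
move=> Gs ok /and3P[gels g1 kle]; have [um sm] := maxlistP Gs ok.
have /andP[/andP[/andP[/allP okg _] _] _] := ok.
apply: sigma_at_ge (dec_ntriv gels g1) _; apply: leq_trans kle _.
pose A := [set M in [seq gen_of gs | gs <- gss]].
have sA : A \subset maximals_containing G s by apply/subsetP=> M; rewrite inE => /sm.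
(* Maximal subgroups over [s] outside the list only increase the sum. *)
rewrite [leqRHS](big_setID A) /= (setIidPr sA) (leq_trans _ (leq_addr _ _)) //.
rewrite (eq_bigl (mem [seq gen_of gs | gs <- gss])) => [|M]; last by rewrite inE.
rewrite -big_uniq //= big_map; apply: eq_leq; rewrite !big_seq; apply: eq_bigr => gs gss_gs.
by rewrite (fusion_count_gen_of cG (okg _ gss_gs)) ?(decK cG) ?(decG cG).
Qed.

End CodedValues.

(** * The group A_6 *)

(* [certs] lists, for each class representative [x], pairs [(i, z)] such that
   conjugating [x] by [z] moves it off the subgroups attached to the [i]-th
   element of [tl], and every nonidentity [y] is moved off them by one pair. *)
Definition matesOK (n : nat) (els tgt gs : seq raw) (tl : seq (raw * seq (seq raw)))
    (certs : seq (raw * seq (nat * raw)%type)) : bool :=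
  let Bs := [seq tries n p.2 | p <- tl] in
  let off e iz := ~~ inlow (nth [::] Bs iz.1) (rconj e iz.2) in
  [&& repcover n els gs [seq c.1 | c <- certs],
      all (fun p => (p.1 \in els) && gen_off n els tgt (tries n p.2) p.1) tl
    & all (fun c =>
        all (fun iz => [&& iz.2 \in els, iz.1 < size tl & off c.1 iz]) c.2 &&
        all (fun y => (y == iota 0 n) || has (off y) c.2) els) certs].

Section Mates.

Variables (gT : finGroupType) (G T : {group gT}) (enc : gT -> raw) (n : nat).
Variables els tgt : seq raw.
Hypotheses (cG : coding G enc n els) (cT : coding T enc n tgt).
Hypotheses (sTG : T \subset G) (nTG : G \subset 'N(T)).

(** Write [x = r ^ w] and [y = y' ^ w]. Some certified [z] moves both [r] and [y'] off the subgroups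
    over [t], so [T] is covered by [t] with [r ^ z] and by [t] with [y' ^ z]. Undoing both
    conjugations, under which [T] is stable, gives the mate. *)
Lemma matesP gs tl certs : matesOK n els tgt gs tl certs ->
  {in G^# &, forall x y, exists t z,
     [/\ t \in [seq p.1 | p <- tl], t \in els, z \in G,
         T \subset <<[set x; dec G enc t ^ z]>>
       & T \subset <<[set y; dec G enc t ^ z]>>]}.
Proof.
rewrite /matesOK; set Bs := [seq _ | _ <- tl].
case/and3P=> rep /allP offB /allP cOK x y G'x /setD1P[y1 Gy].
have [r [w [rr rels Gw ->]]] := repcoverP cG rep G'x.
have [[r' izs] cc /= er] := mapP rr; subst r.
have /andP[/allP izOK /allP yOK] := cOK _ cc.
have Gy' : y ^ w^-1 \in G by rewrite groupJ ?groupV.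
have := yOK _ (mem_enc cG Gy'); rewrite (enc_eq1 cG) //.
rewrite -(inj_eq (conjg_inj w)) conjgKV conj1g (negPf y1) => /hasP[[i z] iz offy].
have /and3P[/= zels ilt offr] := izOK _ iz.
rewrite (nth_map ([::], [::])) // in offy offr; set p := nth _ tl i in offy offr.
have ptl : p \in tl by exact: mem_nth.
have /andP[tels goff] := offB _ ptl.
have Gz := decG cG zels; have Gt := decG cG tels; have Gr := decG cG rels.
have tG a : a \in G -> ~~ inlow (tries n p.2) (rconj (enc a) z) ->
    T \subset <<[set a; dec G enc p.1 ^ (dec G enc z)^-1]>>.
  move=> Ga; rewrite -{1}(decK cG zels) -(encJ cG) // => offa.
  have Gaz := groupJ Ga Gz; rewrite -(decK cG tels) in goff.
  have := gen_offP cG cT sTG Gt goff Gaz offa.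
  rewrite -(conjSg _ _ (dec G enc z)^-1) -genJ2 conjgK.
  by rewrite (normsP nTG) // groupV.
exists p.1, ((dec G enc z)^-1 * w); split=> //.
- exact: map_f.
- by rewrite groupM ?groupV.
- have := tG _ Gr; rewrite (decK cG rels) => /(_ offr).
  by rewrite -(conjSg _ _ w) -genJ2 -conjgM (normsP nTG).
have := tG _ Gy' offy.
by rewrite -(conjSg _ _ w) -genJ2 conjgKV -conjgM (normsP nTG).
Qed.

Lemma no_mate gx gy x y s : x \in G -> y \in G -> s \in G ->
    lowOK n els tgt gx (enc x) -> lowOK n els tgt gy (enc y) ->
    inlow (tries n gx) (enc s) || inlow (tries n gy) (enc s) ->
  ~~ (T \subset <<[set x; s]>> :&: <<[set y; s]>>).
Proof.
move=> Gx Gy Gs lx ly /orP[] low; rewrite subsetI negb_and.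
  by have := inlowP cG cT sTG Gs Gx lx low; rewrite setUC => ->.
by have := inlowP cG cT sTG Gs Gy ly low; rewrite setUC => ->; rewrite orbT.
Qed.

End Mates.

Local Notation E6 := (@encS 5).
Local Notation A6 := alt6_els.
Local Notation dec6 := (dec Alt6 E6).

Definition alt6_reps := [:: alt6_s5; alt6_s5b; alt6_s4; alt6_s2; alt6_s3a; alt6_s3b].
Definition alt6_lows :=
  [:: (alt6_s2, alt6_s2_low); (alt6_s3a, alt6_s3a_low); (alt6_s3b, alt6_s3b_low)].

Lemma alt6_repcover : repcover 6 A6 alt6_gens alt6_reps.
Proof. by vm_compute. Qed.

Lemma alt6_maxpair : all (maxpairOK 6 A6 A6 alt6_M1 alt6_M2) [:: alt6_s5; alt6_s5b].
Proof. by vm_compute. Qed.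

Lemma card_Alt6 : #|Alt6| = 360.
Proof. by rewrite (card_coded coding_Alt6); vm_compute. Qed.

Lemma alt6_rep s : s \in Alt6^# -> exists r y,
  [/\ r \in alt6_reps, dec6 r \in Alt6, E6 (dec6 r) = r, y \in Alt6 & s = dec6 r ^ y].
Proof.
case/(repcoverP coding_Alt6 alt6_repcover)=> r [y [rr rels Gy ->]].
by exists r, y; rewrite (decG coding_Alt6) // (decK coding_Alt6).
Qed.

Lemma alt6_ord5 : all (fun r => isord 6 5 r == (r \in [:: alt6_s5; alt6_s5b])) alt6_reps.
Proof. by vm_compute. Qed.

Lemma alt6_lowsOK : all (fun p => lowOK 6 A6 A6 p.2.2 p.1 &&
  [&& p.2.1 \in A6, p.2.1 != iota 0 6 & 241 <= lowcount A6 (tries 6 p.2.2) p.2.1]) alt6_lows.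
Proof. by vm_compute. Qed.

Lemma alt6_s4OK : maxlistOK 6 A6 alt6_s4_over alt6_s4.
Proof. by vm_compute. Qed.

(** For order 5 the maxima come from involutions. Each of the two [A_5] contains 15 of the 45
    involutions, so its fusion count is 15 * 8 = 120, and the sum is 240. The two groups meet in a
    dihedral group of order 10 with 5 involutions, so the union counts 240 - 5 * 8 = 200. The bounds
    241 and 201 exclude equality for all other orders. *)
Lemma alt6_values s : s \in Alt6^# ->
  if #[s] == 5 then sigma_at Alt6 s = (240%:R / 360%:R)%R
                 /\ nongen_at Alt6 s = (200%:R / 360%:R)%R
  else (241%:R / 360%:R <= sigma_at Alt6 s)%R /\ (201%:R / 360%:R <= nongen_at Alt6 s)%R.
Proof.
case/alt6_rep=> r [y [rr Gr er Gy ->]].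
rewrite orderJ sigma_atJ // nongen_atJ // -(isordE coding_Alt6) // er.
rewrite (eqP (allP alt6_ord5 _ rr)) -card_Alt6; case: ifP => r5.
  have ok := allP alt6_maxpair _ r5; rewrite -er in ok.
  have /and3P[low off _] := ok; split.
    by apply: (sigma_at_pair coding_Alt6 alt6_repcover Gr ok); vm_compute.
  by apply: (nongen_at_exact coding_Alt6 alt6_repcover Gr low off); vm_compute.
have [r4|rlow] : r = alt6_s4 \/ r \in [seq p.1 | p <- alt6_lows].
  have eR : alt6_reps = [:: alt6_s5; alt6_s5b] ++ alt6_s4 :: [seq p.1 | p <- alt6_lows] by [].
  by move: rr; rewrite eR mem_cat r5 inE => /predU1P.
  (* For order 4 sigma is bounded by the sum over four maximal subgroups, two of type [3^2:4] and
     two of type [S_4]. At an involution it is 2 * 72 + 2 * 72 = 288. *)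
  have ok := alt6_s4OK; rewrite -{1}r4 -er in ok; have /andP[/andP[low _] _] := ok.
  split.
    apply: (sigma_at_maxlist coding_Alt6 (g := alt6_s2) Gr ok).
    rewrite unlock; by vm_compute.
  by apply: (nongen_at_low coding_Alt6 (p := (alt6_s2, alt6_s4_over)) Gr low); vm_compute.
have [[r' p] plow /= e] := mapP rlow; subst r'.
have /andP[/= low cnt] := allP alt6_lowsOK _ plow; rewrite -er in low; split.
  exact: (sigma_at_low coding_Alt6 Gr low).
apply: (nongen_at_low coding_Alt6 Gr low).
(* The bound 241 established for sigma exceeds the 201 needed here. *)
by case/and3P: cnt => -> -> le; exact: leq_trans le.
Qed.

Lemma alt6_s5_ord : dec6 alt6_s5 \in Alt6^# /\ #[dec6 alt6_s5] = 5.
Proof.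
have r6 : alt6_s5 \in A6 by vm_compute.
have r1 : alt6_s5 != iota 0 6 by vm_compute.
split; first exact: (dec_ntriv coding_Alt6 r6 r1).
apply/eqP; rewrite -(isordE coding_Alt6 (isT : 0 < 5) (decG coding_Alt6 r6)).
by rewrite (decK coding_Alt6 r6); vm_compute.
Qed.

Lemma sigma_Alt6 : sigma Alt6 = (2%:R / 3%:R)%R.
Proof.
have [G'r o5] := alt6_s5_ord.
rewrite (@frac_eq 2 3 240 360 isT isT isT).
apply: (min_over_eq G'r); first by have := alt6_values G'r; rewrite o5 => -[e _]; exact: e.
move=> s /alt6_values; case: ifP => _ [le _].
  by rewrite le Order.POrderTheory.lexx.
exact: Order.POrderTheory.le_trans (@ler_frac 240 241 360 isT) le.
Qed.

Lemma nongen_Alt6 : nongen Alt6 = (5%:R / 9%:R)%R.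
Proof.
have [G'r o5] := alt6_s5_ord.
rewrite (@frac_eq 5 9 200 360 isT isT isT).
apply: (min_over_eq G'r); first by have := alt6_values G'r; rewrite o5 => -[_ e]; exact: e.
move=> s /alt6_values; case: ifP => _ [_ le].
  by rewrite le Order.POrderTheory.lexx.
exact: Order.POrderTheory.le_trans (@ler_frac 200 201 360 isT) le.
Qed.

Lemma sigma_at_Alt6 s : s \in Alt6^# -> sigma_at Alt6 s = (2%:R / 3%:R)%R <-> #[s] = 5.
Proof.
rewrite (@frac_eq 2 3 240 360 isT isT isT).
move/alt6_values; case: eqP => [-> [-> _]|o5 [le _]]; first by split.
(* Equality would force 241 <= 240. *)
by split=> [e|/o5 []]; rewrite e ler_fracE in le.
Qed.

Lemma nongen_at_Alt6 s : s \in Alt6^# -> nongen_at Alt6 s = (5%:R / 9%:R)%R <-> #[s] = 5.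
Proof.
rewrite (@frac_eq 5 9 200 360 isT isT isT).
move/alt6_values; case: eqP => [-> [_ ->]|o5 [_ le]]; first by split.
by split=> [e|/o5 []]; rewrite e ler_fracE in le.
Qed.

(** * The two classes of [A_5] over elements of order 5 *)

Lemma dec_mkperm n (G : {group {perm 'I_n.+1}}) els e :
  coding G (@encS n) n.+1 els -> e \in els -> validS n e -> dec G (@encS n) e = mkperm n e.
Proof. by move=> cG eels v; apply: encS_inj; rewrite (decK cG) // mkpermK. Qed.

Lemma gen_of_isog_Alt5 gs : altOK 4 alt5_gens ->
    pairOK 4 5 (zip alt5_gens gs) && (unzip1 (zip alt5_gens gs) == alt5_gens) &&
      (unzip2 (zip alt5_gens gs) == gs) && all (fun e => validS 5 e && (e \in A6)) gs ->
  gen_of Alt6 E6 gs \isog 'Alt_('I_5).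
Proof.
move=> okA /andP[/andP[/andP[okP /eqP e1] /eqP e2] /allP v].
have := isog_mkperm_pairs okP; rewrite e1 e2 -(Alt_gen okA) isog_sym.
rewrite /gen_of; suff -> : [seq mkperm 5 e | e <- gs] = [seq dec6 e | e <- gs] by apply.
by apply/eq_in_map => e /v/andP[ve eels]; rewrite (dec_mkperm coding_Alt6).
Qed.

Lemma maximals_Alt6 s : s \in Alt6 -> #[s] = 5 ->
   exists M1 M2 : {group {perm 'I_6}},
     [/\ maximals_containing Alt6 s = [set M1; M2],
         (M2 : {set {perm 'I_6}}) \notin M1 :^: Alt6,
         M1 \isog 'Alt_('I_5) & M2 \isog 'Alt_('I_5)].
Proof.
move=> As os; have A's : s \in Alt6^#.
  by rewrite inE As andbT; apply/set1P=> s1; rewrite s1 order1 in os.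
have [r [y [rr Gr er Gy es]]] := alt6_rep A's.
move: os; rewrite {}es orderJ => /eqP; rewrite -(isordE coding_Alt6) // er.
rewrite (eqP (allP alt6_ord5 _ rr)) => r5.
have ok := allP alt6_maxpair _ r5; rewrite -er in ok.
have /and3P[/andP[/and3P[ok1 ok2 _] _] _ _] := ok.
have {ok} maxE := maxpairP coding_Alt6 Gr ok.
(* The class of 3-cycles separates the two subgroups: it meets the point stabilizer but not the
   transitive [A_5], so the fusion counts differ, while conjugate subgroups have equal ones. *)
have G3 : dec6 alt6_s3a \in Alt6 by apply: (decG coding_Alt6); vm_compute.
have fc1 := fusion_count_gen_of coding_Alt6 ok1 G3.
have fc2 := fusion_count_gen_of coding_Alt6 ok2 G3.
clear ok1 ok2.
exists (gen_of Alt6 E6 alt6_M1 :^ y)%G, (gen_of Alt6 E6 alt6_M2 :^ y)%G; split.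
- by rewrite (maximals_containingJ _ Gy) maxE imsetU1 imset_set1.
- apply/imsetP=> -[z Gz /= eM].
  have eG : ((gen_of Alt6 E6 alt6_M1 :^ y) :^ z)%G = (gen_of Alt6 E6 alt6_M2 :^ y)%G.
    exact/val_inj/esym.
  have := fusion_countJ (gen_of Alt6 E6 alt6_M1 :^ y)%G (dec6 alt6_s3a) Gz.
  have e3 : alt6_s3a \in A6 by vm_compute.
  have fJ M := fusion_countJ M (dec6 alt6_s3a) Gy.
  rewrite eG => h; have := etrans (esym fc2) (etrans (esym (fJ _)) (etrans h (etrans (fJ _) fc1))).
  by rewrite (decK coding_Alt6 e3); vm_compute.
- rewrite isog_sym; apply: isog_trans (conj_isog _ _); rewrite isog_sym.
  by apply: gen_of_isog_Alt5; vm_compute.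
rewrite isog_sym; apply: isog_trans (conj_isog _ _); rewrite isog_sym.
by apply: gen_of_isog_Alt5; vm_compute.
Qed.

(** * The three involutions of a four-group, and the spread of [A_6] *)

Definition swap (k l i : nat) : nat := if i == k then l else if i == l then k else i.

Lemma encS_double_transp a b c d : all (fun k => 0 < k <= 6) [:: a; b; c; d] ->
  E6 (double_transp a b c d) = [seq swap c.-1 d.-1 (swap a.-1 b.-1 i) | i <- iota 0 6].
Proof.
case/and5P=> a6 b6 c6 d6 _.
have ptE k : 0 < k <= 6 -> k.-1 = pt k :> nat.
  by case/andP=> k0 k6; rewrite inordK // prednK.
have tpE k l (i : 'I_6) : 0 < k <= 6 -> 0 < l <= 6 ->
    tperm (pt k) (pt l) i = swap k.-1 l.-1 i :> nat.
  move=> /ptE-> /ptE->; rewrite permE /= /swap -!(inj_eq val_inj) /=.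
  by case: ifP => // _; case: ifP.
rewrite -(val_enum_ord 6) -map_comp; apply: eq_map => i /=.
by rewrite permM !tpE.
Qed.

Lemma klein_lowsOK :
  [&& lowOK 6 A6 A6 klein_low1 [:: 1; 0; 3; 2; 4; 5]%N,
      lowOK 6 A6 A6 klein_low2 [:: 2; 3; 0; 1; 4; 5]%N,
      lowOK 6 A6 A6 klein_low3 [:: 3; 2; 1; 0; 4; 5]%N
    & let t1 := tries 6 klein_low1 in let t2 := tries 6 klein_low2 in
      let t3 := tries 6 klein_low3 in
      all (fun e => [|| inlow t1 e, inlow t2 e | inlow t3 e]) A6].
Proof. by vm_compute. Qed.

Lemma double_transp_Alt6 a b c d : uniq [:: a; b; c; d] ->
  all (fun k => 0 < k <= 6) [:: a; b; c; d] -> double_transp a b c d \in Alt6^#.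
Proof.
move=> /and4P[na nb nc _] rng; have e := encS_double_transp rng.
have pt_inj k l : 0 < k <= 6 -> 0 < l <= 6 -> k != l -> pt k != pt l.
  case/andP=> k0 k6 /andP[l0 l6]; apply: contraNneq => /(congr1 val) /=.
  by rewrite !inordK ?prednK // => e1; rewrite -(prednK k0) e1 prednK.
case/and5P: rng => a6 b6 c6 d6 _.
have [/and3P[ab ac ad] /andP[bc bd] cd] :
    [/\ [&& a != b, a != c & a != d], (b != c) && (b != d) & c != d].
  by move: na nb nc; rewrite !inE !negb_or.
apply/setD1P; split; last by rewrite Alt_even odd_permM !odd_tperm !pt_inj.
apply/eqP=> /permP/(_ (pt a)); rewrite permM perm1 tpermL.
rewrite tpermD ?pt_inj //; last by rewrite eq_sym.
  by apply/eqP; rewrite eq_sym pt_inj.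
by rewrite eq_sym.
Qed.

Lemma klein_nongen g : g \in Alt6 ->
   exists2 x, x \in [set double_transp 1 2 3 4; double_transp 1 3 2 4;
                         double_transp 1 4 2 3]
            & <<[set g; x]>> \proper Alt6.
Proof.
move=> Gg; have /and4P[l1 l2 l3 l4] := klein_lowsOK.
have low := all_coded coding_Alt6 l4 Gg; clear l4.
have key x gss : x \in Alt6 -> lowOK 6 A6 A6 gss (E6 x) -> inlow (tries 6 gss) (E6 g) ->
    <<[set g; x]>> \proper Alt6.
  move=> Gx lx lg; rewrite properE.
  rewrite (inlowP coding_Alt6 coding_Alt6 (subxx _) Gg Gx lx lg) andbT.
  by rewrite gen_subG; apply/subsetP=> z /set2P[] ->.
have {key} key a b c d gss : uniq [:: a; b; c; d] ->
    all (fun k => 0 < k <= 6) [:: a; b; c; d] ->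
    lowOK 6 A6 A6 gss [seq swap c.-1 d.-1 (swap a.-1 b.-1 i) | i <- iota 0 6] ->
    inlow (tries 6 gss) (E6 g) -> <<[set g; double_transp a b c d]>> \proper Alt6.
  move=> u r l; apply: key; last by rewrite (encS_double_transp r).
  by case/setD1P: (double_transp_Alt6 u r).
case/or3P: low => lg.
- exists (double_transp 1 2 3 4); first by apply/setUP; left; exact: set21.
  exact: (key 1%N 2 3 4 _ isT isT l1 lg).
- exists (double_transp 1 3 2 4); first by apply/setUP; left; exact: set22.
  exact: (key 1%N 3 2 4 _ isT isT l2 lg).
exists (double_transp 1 4 2 3); first by apply/setUP; right; exact: set11.
exact: (key 1%N 4 2 3 _ isT isT l3 lg).
Qed.

Lemma alt6_matesOK : matesOK 6 A6 A6 alt6_gens [:: (alt6_s4, alt6_s4_over)] alt6_certs.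
Proof. by vm_compute. Qed.

Lemma gen2_eq (gT : finGroupType) (G : {group gT}) (x y : gT) :
  x \in G -> y \in G -> G \subset <<[set x; y]>> -> <<[set x; y]>> = G.
Proof.
by move=> Gx Gy sG; apply/eqP; apply: contraT; rewrite gen2_neqE // sG.
Qed.

Lemma alt6_common_mates : common_mates_in Alt6 (dec6 alt6_s4 ^: Alt6) 2.
Proof.
move=> g gG; have [t [z [ts tA Az s1 s2]]] :=
  matesP coding_Alt6 coding_Alt6 (subxx _) (normG _) alt6_matesOK (gG ord0) (gG ord_max).
have {ts} et : t = alt6_s4 by move: ts; rewrite inE => /eqP.
subst t; have As := decG coding_Alt6 tA.
exists (dec6 alt6_s4 ^ z); first exact: memJ_class.
have gA i : g i \in Alt6 by case/setD1P: (gG i).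
move=> i; apply: (gen2_eq (gA i) (groupJ As Az)).
have [-> //|ne] := eqVneq i ord0.
suff -> : i = ord_max by [].
apply/val_inj; case: i ne => [[|[|k]] //].
Qed.

Lemma alt6_s4_class : [/\ dec6 alt6_s4 ^: Alt6 \in classes Alt6,
  forall s, s \in dec6 alt6_s4 ^: Alt6 -> #[s] = 4 & dec6 alt6_s4 \in Alt6].
Proof.
have tA : alt6_s4 \in A6 by vm_compute.
have As := decG coding_Alt6 tA; split=> //; first exact: mem_classes.
move=> _ /imsetP[z _ ->]; rewrite orderJ; apply/eqP.
by rewrite -(isordE coding_Alt6 (isT : 0 < 4) As) (decK coding_Alt6 tA); vm_compute.
Qed.

Lemma common_mates_sub (gT : finGroupType) (G : {group gT}) (C D : {set gT}) k :
  C \subset D -> common_mates_in G C k -> common_mates_in G D k.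
Proof. by move=> sCD m g /m[s /(subsetP sCD) ? ?]; exists s. Qed.

Lemma class_sub_of_classes (gT : finGroupType) (G : {group gT}) C :
  C \in classes G -> C \subset G.
Proof. by case/imsetP=> x Gx ->; rewrite class_subG. Qed.

(** The three involutions of part (d) have no common mate. *)
Lemma not_spread3_Alt6 : ~ spread_at_least Alt6 3.
Proof.
pose g (i : 'I_3) := nth 1 [:: double_transp 1 2 3 4; double_transp 1 3 2 4;
                              double_transp 1 4 2 3] i.
have gG i : g i \in Alt6^#.
  by case: i => [[|[|[|k]]] //= lt]; rewrite /g /=; apply: double_transp_Alt6.
case/(_ g gG) => s As gen; have [x xs] := klein_nongen As.
have [i ->] : exists i, x = g i.
  case/setUP: xs => [/set2P[]|/set1P] ->.
  - by exists (@Ordinal 3 0 isT).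
  - by exists (@Ordinal 3 1 isT).
  by exists (@Ordinal 3 2 isT).
by rewrite setUC gen properxx.
Qed.

Lemma spread_Alt6 : [/\ spread_exactly Alt6 2, uniform_spread_exactly Alt6 2
    & exists C, [/\ C \in classes Alt6, (forall s, s \in C -> #[s] = 4)
                  & common_mates_in Alt6 C 2]].
Proof.
have [cC o4 As] := alt6_s4_class; have m := alt6_common_mates.
have sC := class_sub_of_classes cC.
split; last by exists (dec6 alt6_s4 ^: Alt6).
  by split; [exact: common_mates_sub sC m | exact: not_spread3_Alt6].
split; first by exists (dec6 alt6_s4 ^: Alt6).
case=> C /class_sub_of_classes sC3 m3; apply: not_spread3_Alt6.
exact: common_mates_sub sC3 m3.
Qed.

(** * Common mates in S_6 *)

Local Notation S6 := sym6_els.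
Local Notation decS := (dec Sym6 E6).

Lemma sym6_matesOK : matesOK 6 S6 A6 sym6_gens sym6_mates sym6_certs.
Proof. by vm_compute. Qed.

Lemma sym6_mate x y : x \in Sym6^# -> y \in Sym6^# ->
  exists2 s, s \in Sym6 & Alt6 \subset <<[set x; s]>> :&: <<[set y; s]>>.
Proof.
move=> Gx Gy.
have [t [z [_ _ _ s1 s2]]] :=
  matesP coding_Sym6 coding_Alt6 (Alt_subset _) (Alt_norm _) sym6_matesOK Gx Gy.
by exists (decS t ^ z); [exact: in_setT | rewrite subsetI s1].
Qed.

Definition noMateOK (p : (raw * raw * seq (seq raw) * seq (seq raw))%type) (l : seq raw) :=
  let: (x, y, gx, gy) := p in
  let tx := tries 6 gx in let ty := tries 6 gy in
  [&& x \in S6, y \in S6, x != iota 0 6, y != iota 0 6,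
      lowOK 6 S6 A6 gx x, lowOK 6 S6 A6 gy y
    & all (fun e => inlow tx e || inlow ty e) l].

Lemma noMateP p l : noMateOK p l ->
  exists x y, [/\ x \in Sym6^#, y \in Sym6^#
    & forall s, s \in Sym6 -> E6 s \in l ->
        ~~ (Alt6 \subset <<[set x; s]>> :&: <<[set y; s]>>)].
Proof.
case: p => [[[x y] gx] gy] /and4P[xS yS x1 /and4P[y1 lx ly /allP low]].
exists (decS x), (decS y); split.
- exact: (dec_ntriv coding_Sym6 xS x1).
- exact: (dec_ntriv coding_Sym6 yS y1).
move=> s Ss /low; rewrite -(decK coding_Sym6 xS) in lx; rewrite -(decK coding_Sym6 yS) in ly.
exact: (no_mate coding_Sym6 coding_Alt6 (Alt_subset _)
  (decG coding_Sym6 xS) (decG coding_Sym6 yS) Ss lx ly).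
Qed.

Lemma sym6_neg_evenOK : noMateOK sym6_neg_even A6.
Proof. by vm_compute. Qed.

Lemma sym6_no_even_mate : exists x y, [/\ x \in Sym6^#, y \in Sym6^#
  & forall s, s \in Alt6 -> ~~ (Alt6 \subset <<[set x; s]>> :&: <<[set y; s]>>)].
Proof.
have [x [y [Sx Sy no]]] := noMateP sym6_neg_evenOK.
exists x, y; split=> // s As; apply: no; first exact: in_setT.
exact: (mem_enc coding_Alt6).
Qed.

(** The list of all conjugates of [q.1] runs through its class, with repetitions. *)
Lemma sym6_neg_oddOK :
  all (fun q => noMateOK q.2 [seq rconj q.1 e | e <- S6]) sym6_neg_odd.
Proof. by vm_compute. Qed.

Lemma sym6_reps_parity : all (fun r => (r \in A6) || (r \in [seq q.1 | q <- sym6_neg_odd]))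
  [seq c.1 | c <- sym6_certs].
Proof. by vm_compute. Qed.

Lemma sym6_repcover : repcover 6 S6 sym6_gens [seq c.1 | c <- sym6_certs].
Proof. by vm_compute. Qed.

Lemma sym6_no_class_mate C : C \in classes Sym6 ->
  exists x y, [/\ x \in Sym6^#, y \in Sym6^#
    & forall s, s \in C -> ~~ (Alt6 \subset <<[set x; s]>> :&: <<[set y; s]>>)].
Proof.
case/imsetP=> s0 Ss0 ->.
(* An even class lies in [A_6], so one pair [x], [y] serves all even classes. The trivial class is
   among them, which matters because the representatives below cover only nonidentity elements. *)
have even : s0 \in Alt6 -> exists x y, [/\ x \in Sym6^#, y \in Sym6^#
    & forall s, s \in s0 ^: Sym6 -> ~~ (Alt6 \subset <<[set x; s]>> :&: <<[set y; s]>>)].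
  move=> As0; have [x [y [Sx Sy no]]] := sym6_no_even_mate; exists x, y; split=> // s ss0.
  by apply: no; apply: subsetP ss0; rewrite class_sub_norm // Alt_norm.
have [s01|s01] := eqVneq s0 1; first by apply: even; rewrite s01 group1.
have G's0 : s0 \in Sym6^# by apply/setD1P.
have [r [y0 [rr rS Sy0 e0]]] := repcoverP coding_Sym6 sym6_repcover G's0.
have /orP[rA|/mapP[q qo er]] := allP sym6_reps_parity _ rr.
  apply: even; rewrite e0 memJ_norm; last exact: (subsetP (Alt_norm _) _ Sy0).
  suff -> : decS r = dec6 r by exact: (decG coding_Alt6 rA).
  by apply: encS_inj; rewrite (decK coding_Sym6 rS) (decK coding_Alt6 rA).
have [x [y [Sx Sy no]]] := noMateP (allP sym6_neg_oddOK _ qo).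
exists x, y; split=> // s; rewrite e0 classGidl // => /imsetP[w Sw ->].
apply: no; first exact: in_setT.
rewrite (encJ coding_Sym6 (decG coding_Sym6 rS) Sw) (decK coding_Sym6 rS) er.
exact/map_f/(mem_enc coding_Sym6).
Qed.

(** * The groups A_6.2 *)

Section AutBound.

Variables (gT : finGroupType) (G : {group gT}).

Lemma Aut_morphM a : a \in Aut G -> {in G &, {morph a : x y / x * y}}.
Proof. by move=> Aa x y Gx Gy; rewrite -(autmE Aa) morphM. Qed.

Lemma Aut_morph1 a : a \in Aut G -> a 1 = 1.
Proof. by move=> Aa; rewrite -(autmE Aa) morph1. Qed.

Lemma Aut_morphX a x k : a \in Aut G -> x \in G -> a (x ^+ k) = a x ^+ k.
Proof. by move=> Aa Gx; rewrite -(autmE Aa) morphX. Qed.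

(** Orbit and stabilizer of [x]: the orbit consists of elements of the order of [x], and an
    automorphism fixing [x] is determined by the image of [y]. *)
Lemma card_Aut_le x y (rel : gT -> bool) :
    x \in G -> y \in G -> G \subset <<[set x; y]>> ->
    (forall a, a \in Aut G -> a x = x -> rel (a y)) ->
  #|Aut G| <= #|[set z in G | #[z] == #[x]]| * #|[set z in G | rel z]|.
Proof.
move=> Gx Gy genG relP; rewrite -(card_orbit_stab 'P (Aut G) x) leq_mul //.
  apply/subset_leq_card/subsetP=> _ /orbitP[a Aa <-] /=.
  rewrite inE /aperm Aut_closed //= -(autmE Aa).
  by rewrite (order_injm (injm_autm Aa)) // eqxx.
rewrite -(card_in_imset (f := fun a : {perm gT} => a y)) /=.
  apply/subset_leq_card/subsetP=> _ /imsetP[a /setIP[Aa /astab1P ax] ->].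
  by rewrite inE Aut_closed // relP.
move=> a b /setIP[Aa /astab1P ax] /setIP[Ab /astab1P bx] /= ab.
apply: (eq_Aut Aa Ab) => z Gz.
(* The elements on which two automorphisms agree form a subgroup, which here contains both
   generators. *)
have : G \subset [set z in G | a z == b z].
  have gs : group_set [set z in G | a z == b z].
    apply/group_setP; split=> [|u v]; first by rewrite inE group1 !Aut_morph1 ?eqxx.
    rewrite !inE => /andP[Gu /eqP eu] /andP[Gv /eqP ev].
    by rewrite groupM // !Aut_morphM // eu ev eqxx.
  apply: subset_trans genG _; rewrite (gen_subG _ (Group gs)).
  apply/subsetP=> u /set2P[] ->; rewrite inE ?Gx ?Gy ?ab ?eqxx //=.
  by move: ax bx; rewrite /= /aperm => -> ->.
by move/subsetP/(_ z Gz); rewrite inE Gz => /eqP.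
Qed.

End AutBound.

(** The relators [(x z)^4] and [(x z^2)^3] hold for [z = alt6_s5] and leave 16 candidates [z] in
    all. As 16 = 1440 / 90, the resulting bound is sharp. *)
Definition alt6_rel (x z : raw) : bool :=
  (rpow 6 (rmul x z) 4 == iota 0 6) && (rpow 6 (rmul x (rmul z z)) 3 == iota 0 6).

Lemma alt6_relOK :
  [&& alt6_s4 \in A6, alt6_s5 \in A6, covers 6 A6 [:: alt6_s4; alt6_s5], alt6_rel alt6_s4 alt6_s5,
      isord 6 4 alt6_s4, count (isord 6 4) A6 == 90 & count (alt6_rel alt6_s4) A6 == 16].
Proof. by vm_compute. Qed.

Lemma card_Aut_Alt6 : #|Aut Alt6| <= 1440.
Proof.
have relE u v : u \in Alt6 -> v \in Alt6 ->
    alt6_rel (E6 u) (E6 v) = ((u * v) ^+ 4 == 1) && ((u * (v * v)) ^+ 3 == 1).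
  move=> Gu Gv; rewrite /alt6_rel -!encSM -!encSX -(encS1 5).
  by rewrite !(inj_eq (@encS_inj 5)).
have sAE (x y : {perm 'I_6}) : x \in Alt6 -> y \in Alt6 -> {subset [:: x; y] <= Alt6}.
  by move=> Gx Gy z; rewrite in_cons mem_seq1 => /pred2P[] ->.
have setE (x y : {perm 'I_6}) : [set z in [:: x; y]] = [set x; y].
  by apply/setP=> z; rewrite inE in_cons mem_seq1 in_set2.
have /and4P[xA yA cov /and4P[rxy ox /eqP c4 /eqP c16]] := alt6_relOK.
have [Gx Gy] := (decG coding_Alt6 xA, decG coding_Alt6 yA).
have [ex ey] := (decK coding_Alt6 xA, decK coding_Alt6 yA).
set x := dec6 _ in Gx ex; set y := dec6 _ in Gy ey.
have := covers_gen coding_Alt6 coding_Alt6 (subxx _) (sAE _ _ Gx Gy).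
rewrite (_ : map _ _ = [:: alt6_s4; alt6_s5]) ?setE; last by rewrite -ex -ey.
move/(_ cov) => genG.
have {}ox : #[x] = 4.
  by apply/eqP; rewrite -(isordE coding_Alt6 (isT : 0 < 4) Gx) ex.
rewrite -ex -ey (relE _ _ Gx Gy) in rxy; clear cov xA yA.
have -> : 1440 = (90 * 16)%N by [].
rewrite -c4 -c16 -(count_coded_eq coding_Alt6 (A := fun z => #[z] == #[x])); last first.
  by move=> z Gz; rewrite (isordE coding_Alt6 (isT : 0 < 4) Gz) ox.
rewrite -(count_coded coding_Alt6).
apply: (@card_Aut_le _ _ x y (fun z => alt6_rel alt6_s4 (E6 z)) Gx Gy genG).
move=> a Aa ax; rewrite -ex relE ?Aut_closed //; case/andP: rxy => /eqP r4 /eqP r3.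
have Gyy := groupM Gy Gy; have Gxy := groupM Gx Gy; have Gxyy := groupM Gx Gyy.
rewrite -{1 2}ax -!(Aut_morphM Aa) // -!(Aut_morphX _ Aa) //.
by rewrite r4 r3 !(Aut_morph1 Aa) eqxx.
Qed.

(** * Subgroups containing a given subgroup with index two *)

Section IndexTwo.

Variables (gT : finGroupType) (A I : {group gT}).
Hypothesis leA : #|A| <= 4 * #|I|.

Definition index2_over (H : {group gT}) := [&& I \subset H, H \subset A & #|H| == (2 * #|I|)%N].

Lemma index2_over_disjoint H K : index2_over H -> index2_over K -> H != K ->
  (H :\: I) :&: (K :\: I) = set0.
Proof.
case/and3P=> IH HA /eqP cH /and3P[IK KA /eqP cK]; apply: contraNeq.
case/set0Pn=> x; rewrite !inE => /andP[/andP[Ix Hx] /andP[_ Kx]].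
have sI : I \subset H :&: K by rewrite subsetI IH.
(* A common element outside [I] makes the intersection at least twice as large as [I], hence equal
   to both [H] and [K]. *)
have [m cm] := dvdnP (cardSg sI).
have m1 : 1 < m.
  rewrite ltnNge; apply/negP=> m1; case/negP: Ix.
  have /eqP -> : I :==: H :&: K; last by rewrite inE Hx.
  by rewrite eqEcard sI cm -[leqRHS]mul1n leq_mul2r m1 orbT.
have key (X : {group gT}) : #|X| = (2 * #|I|)%N -> H :&: K \subset X -> H :&: K = X.
  by move=> cX sX; apply/eqP; rewrite eqEcard sX cX cm leq_mul2r m1 orbT.
have eH := key H cH (subsetIl _ _); have eK := key K cK (subsetIr _ _).
by apply/eqP/val_inj; rewrite /= -eH.
Qed.

Lemma index2_over_three H H1 H2 H3 : index2_over H -> index2_over H1 ->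
  index2_over H2 -> index2_over H3 -> H1 != H2 -> H1 != H3 -> H2 != H3 ->
  [|| H == H1, H == H2 | H == H3].
Proof.
move=> oH o1 o2 o3 n12 n13 n23; apply: contraT; rewrite !negb_or => /and3P[n1 n2 n3].
have dI X : index2_over X -> #|X :\: I| = #|I|.
  by case/and3P=> IX _ /eqP cX; rewrite cardsD (setIidPr IX) cX mul2n -addnn addnK.
have dis := index2_over_disjoint.
(* Four different subgroups would give four disjoint cosets besides [I], that is [5 * |I|] elements,
   more than [A] has. *)
pose U := (H :\: I) :|: (H1 :\: I) :|: (H2 :\: I) :|: (H3 :\: I) :|: I.
have cU : #|U| = (5 * #|I|)%N.
  rewrite /U !cardsU !setIUl (dis _ _ _ _ n1) // (dis _ _ _ _ n2) // (dis _ _ _ _ n3) //.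
  rewrite (dis _ _ _ _ n12) // (dis _ _ _ _ n13) // (dis _ _ _ _ n23) //.
  rewrite !(setIC (_ :\: _) I) !setIDA !(setDIl I) !setDv.
  rewrite !set0I ?setI0 !set0U !cards0 !subn0 !dI //.
  by rewrite !mulSn mul0n addn0 !addnA.
have : U \subset A.
  have sX X : index2_over X -> X :\: I \subset A.
    by case/and3P=> _ XA _; apply: subset_trans XA; exact: subsetDl.
  rewrite !subUset !sX //=; case/and3P: oH => IH HA _; exact: subset_trans HA.
move/subset_leq_card; rewrite cU => /leq_trans/(_ leA).
by rewrite leq_pmul2r ?cardG_gt0.
Qed.

End IndexTwo.

Section Extension.

(* [K] acts faithfully by conjugation on its normal subgroup [K0], and the
   action is transported to [f @* K0]. *)
Variables (gT rT : finGroupType) (K K0 : {group gT}) (f : {morphism K0 >-> rT}).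
Hypotheses (injf : 'injm f) (nK : K0 <| K) (cK : 'C_K(K0) = 1).

Definition ext_fun (k : gT) : {perm rT} := Aut_isom injf (subxx K0) (conj_aut K0 k).

Let nKk k : k \in K -> k \in 'N(K0).
Proof. by case/andP: nK => _ /subsetP; apply. Qed.

Let conjA k : conj_aut K0 k \in Aut K0.
Proof. exact: Aut_aut. Qed.

Lemma ext_funE k x : k \in K -> x \in K0 -> ext_fun k (f x) = f (x ^ k).
Proof. by move=> Kk K0x; rewrite Aut_isomE // norm_conj_autE ?nKk. Qed.

Lemma ext_fun_Aut k : ext_fun k \in Aut (f @* K0).
Proof. exact: Aut_Aut_isom. Qed.

Lemma ext_funM : {in K &, {morph ext_fun : x y / x * y}}.
Proof.
move=> x y Kx Ky; rewrite /ext_fun -Aut_isomM //; congr (Aut_isom _ _ _).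
by apply: conj_aut_morphM; exact: nKk.
Qed.

Definition ext_morphism := Morphism ext_funM.

(** The kernel is the centralizer of [K0] in [K]. *)
Lemma injm_ext : 'injm ext_morphism.
Proof.
apply/subsetP=> k /morphpreP[Kk /set1P /= fk]; rewrite -cK inE Kk.
apply/centP=> x K0x; apply/commute_sym/commgP/conjg_fixP.
apply: (injmP injf); rewrite ?memJ_norm ?nKk //.
by rewrite -ext_funE // fk perm1.
Qed.

Lemma im_ext_Aut : ext_morphism @* K \subset Aut (f @* K0).
Proof. by apply/subsetP=> _ /morphimP[k _ _ ->]; exact: ext_fun_Aut. Qed.

(** Conjugation by [k] in [K0] becomes conjugation by [f k]. This places the image of [K] over the
    inner automorphisms. *)
Lemma im_ext_Inn : ext_morphism @* K0 = conj_aut (f @* K0)%G @* (f @* K0).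
Proof.
have sK : K0 \subset K := normal_sub nK.
have key k : k \in K0 -> ext_fun k = conj_aut (f @* K0)%G (f k).
  move=> K0k; apply: (eq_Aut (ext_fun_Aut k)); first exact: Aut_aut.
  move=> _ /morphimP[x _ K0x ->]; have Kk := subsetP sK _ K0k.
  by rewrite ext_funE // conj_autE ?mem_morphim // morphJ.
apply/setP=> a; apply/morphimP/morphimP => [[k _ K0k ->]|[_ _ /morphimP[k _ K0k ->] ->]].
  exists (f k); rewrite ?mem_morphim //=; last exact: key.
  exact: (subsetP (normG _)) (mem_morphim _ _ _).
by exists k; rewrite ?(subsetP sK) //= key.
Qed.

End Extension.

Lemma coding_sub (gT : finGroupType) (G H : {group gT}) enc n els els0 :
    coding G enc n els -> H \subset G -> uniq els0 -> {subset els0 <= els} ->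
    {in G, forall x, (x \in H) = (enc x \in els0)} ->
  coding H enc n els0.
Proof.
move=> cG /subsetP sHG u0 s0 memH; case: (cG) => inj eM eV e1 Eels _; split=> //.
- exact: sub_in2 inj.
- exact: sub_in2 eM.
- exact: sub_in1 eV.
move=> e; split=> [e0|[x Hx ->]]; last by rewrite -memH // sHG.
have [x Gx ex] := (Eels e).1 (s0 _ e0).
by exists x; rewrite // memH // -ex.
Qed.

Lemma has_order (gT : finGroupType) (G : {group gT}) enc n els k :
    coding G enc n els -> 0 < k ->
  (exists2 s, s \in G & #[s] = k) <-> has (isord n k) els.
Proof.
move=> cG k0; split=> [[s Gs os]|/hasP[e /(cod_els cG)[s Gs ->]]].
  by apply/hasP; exists (enc s); [exact: mem_enc cG _ Gs | rewrite (isordE cG) // os].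
by rewrite (isordE cG) // => /eqP; exists s.
Qed.

Definition trivcent (n : nat) (els gs : seq raw) : bool :=
  all (fun e => (e == iota 0 n) || has (fun g => rmul e g != rmul g e) gs) els.

Lemma trivcentP (gT : finGroupType) (G H : {group gT}) enc n els els0 gs :
    coding G enc n els -> coding H enc n els0 -> H \subset G ->
    trivcent n els gs && all (mem els0) gs ->
  'C_G(H) = 1.
Proof.
move=> cG cH /subsetP sHG /andP[/allP tr /allP g0].
apply/trivgP/subsetP=> x /setIP[Gx /centP cx]; rewrite inE -(enc_eq1 cG Gx).
have /orP[//|/hasP[g /g0/(cod_els cH)[h Hh ->]]] := tr _ (mem_enc cG Gx).
have Gh := sHG _ Hh; have xh : x * h = h * x := cx h Hh.
by rewrite -(codM cG Gx Gh) xh (codM cG Gh Gx) eqxx.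
Qed.

(* The group with code [els], containing a copy of [A_6] with code [els0] as a
   subgroup of index 2 with trivial centralizer. *)
Lemma A6_ext2_model n (K K0 : {group {perm 'I_n.+1}}) els els0 gs :
    coding K (@encS n) n.+1 els -> coding K0 (@encS n) n.+1 els0 -> K0 \isog Alt6 ->
    [&& size els == 720, all (mem els) els0 & trivcent n.+1 els gs && all (mem els0) gs] ->
  exists (H : {group {perm {perm 'I_6}}}) enc,
    [/\ coding H enc n.+1 els, coding Inn_Alt6 enc n.+1 els0,
        index2_over [group of Aut Alt6] Inn_Alt6 H & K \isog H].
Proof.
move=> cK cK0 /isogP[f injf fK0] /and3P[/eqP s720 /allP s0 tr].
have sK : K0 \subset K.
  apply/subsetP=> x K0x; have [y Ky] := (cod_els cK _).1 (s0 _ (mem_enc cK0 K0x)).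
  by move/encS_inj->.
have eA : (f @* K0)%G = Alt6 by apply/val_inj.
have cardK0 : #|K0| = 360 by rewrite -card_Alt6 -fK0 card_injm.
have nK : K0 <| K.
  apply: index2_normal => //; rewrite -divgS // (card_coded cK) s720 cardK0 //.
have cc := trivcentP cK cK0 sK tr; clear tr.
pose F := ext_morphism injf nK; have injF : 'injm F := injm_ext injf nK cc.
have FI : F @* K0 = Inn_Alt6.
  have InnE (B : {group {perm 'I_6}}) : B = Alt6 -> conj_aut B @* B = Inn_Alt6 by move->.
  exact: etrans (im_ext_Inn injf nK) (InnE _ eA).
have FA : F @* K \subset Aut Alt6 by rewrite -fK0; exact: im_ext_Aut.
have cFK := coding_injm injF cK.
exists (F @* K)%G, (@encS n \o invm injF); split; first exact: cFK.
- have -> : Inn_Alt6 = (F @* K0)%G by apply/val_inj.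
  apply: coding_sub cFK _ (cod_uniq cK0) s0 _; first exact: morphimS.
  move=> _ /morphimP[k _ Kk ->] /=; rewrite invmE //.
  apply/idP/idP=> [/morphimP[k0 Kk0 K0k0 /(injmP injF _ _ Kk Kk0)->]|].
    exact: (mem_enc cK0 K0k0).
  by case/(cod_els cK0)=> y K0y /encS_inj ky; apply: mem_morphim; rewrite // ky.
- apply/and3P; split=> //; first by rewrite -FI morphimS.
  by rewrite -FI !card_injm // cardK0 (card_coded cK) s720.
exact: sub_isog.
Qed.

Lemma coding_mkperm_eq n gs els : codingOK n gs && (els == rclos n.+1 gs) ->
  coding <<[set g in [seq mkperm n e | e <- gs]]>> (@encS n) n.+1 els.
Proof. by case/andP=> ok /eqP->; exact: coding_mkperm. Qed.

Lemma psl29_isog : <<[set g in [seq mkperm 9 e | e <- psl29_gens]]>> \isog Alt6.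
Proof.
have okP : pairOK 9 5 (zip psl29_gens alt6_gens) by vm_compute.
have okA : altOK 5 alt6_gens by vm_compute.
have := isog_mkperm_pairs okP.
have -> : unzip1 (zip psl29_gens alt6_gens) = psl29_gens by vm_compute.
have -> : unzip2 (zip psl29_gens alt6_gens) = alt6_gens by vm_compute.
by rewrite -(Alt_gen okA); apply.
Qed.

Lemma coding_psl29 :
  coding <<[set g in [seq mkperm 9 e | e <- psl29_gens]]>> (@encS 9) 10 psl29_els.
Proof. by apply: coding_mkperm_eq; vm_compute. Qed.

Lemma coding_pgl29 :
  coding <<[set g in [seq mkperm 9 e | e <- pgl29_gens]]>> (@encS 9) 10 pgl29_els.
Proof. by apply: coding_mkperm_eq; vm_compute. Qed.

Lemma coding_m10 : coding <<[set g in [seq mkperm 9 e | e <- m10_gens]]>> (@encS 9) 10 m10_els.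
Proof. by apply: coding_mkperm_eq; vm_compute. Qed.

Lemma sym6_model : [&& size S6 == 720, all (mem S6) A6
  & trivcent 6 S6 alt6_gens && all (mem A6) alt6_gens].
Proof. by vm_compute. Qed.

Lemma pgl29_model : [&& size pgl29_els == 720, all (mem pgl29_els) psl29_els
  & trivcent 10 pgl29_els psl29_gens && all (mem psl29_els) psl29_gens].
Proof. by vm_compute. Qed.

Lemma m10_model : [&& size m10_els == 720, all (mem m10_els) psl29_els
  & trivcent 10 m10_els psl29_gens && all (mem psl29_els) psl29_gens].
Proof. by vm_compute. Qed.

(** Element orders tell the three extensions apart: order 8 occurs in [PGL(2,9)] and [M_10] but not
    in [S_6], and order 10 in [PGL(2,9)] but not in [M_10]. *)
Lemma ext2_orders : [&& ~~ has (isord 6 8) S6, has (isord 10 8) pgl29_els, has (isord 10 8) m10_els,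
  has (isord 10 10) pgl29_els & ~~ has (isord 10 10) m10_els].
Proof. by vm_compute. Qed.

Lemma isog_order (gT rT : finGroupType) (G : {group gT}) (H : {group rT}) k :
  G \isog H -> (exists2 s, s \in G & #[s] = k) -> exists2 s, s \in H & #[s] = k.
Proof.
case/isogP=> f injf <- [s Gs <-]; exists (f s); first exact: mem_morphim.
exact: order_injm.
Qed.

Lemma exotic_index2 H : exotic_A6_ext2 H =
  index2_over [group of Aut Alt6] Inn_Alt6 H && ~~ (H \isog Sym6).
Proof.
rewrite /exotic_A6_ext2 /index2_over; case IH: (Inn_Alt6 \subset H) => //=.
rewrite -(Lagrange IH) mulnC eqn_pmul2r ?cardG_gt0 //.
by case: (H \subset _) => //=; case: (_ == 2).
Qed.

Lemma A6_ext2_classification : exists HP eP HM eM,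
  [/\ coding HP eP 10 pgl29_els, coding Inn_Alt6 eP 10 psl29_els,
      coding HM eM 10 m10_els & coding Inn_Alt6 eM 10 psl29_els] /\
  [/\ forall H, exotic_A6_ext2 H -> H = HP \/ H = HM, exotic_A6_ext2 HP & exotic_A6_ext2 HM].
Proof.
have [HS [eS [cS cSI oS isoS]]] := A6_ext2_model coding_Sym6 coding_Alt6 (isog_refl _) sym6_model.
have [HP [eP [cP cPI oP isoP]]] := A6_ext2_model coding_pgl29 coding_psl29 psl29_isog pgl29_model.
have [HM [eM [cM cMI oM isoM]]] := A6_ext2_model coding_m10 coding_psl29 psl29_isog m10_model.
have /and4P[nS8 P8 M8 /andP[P10 nM10]] := ext2_orders.
have ordS := has_order coding_Sym6 (isT : 0 < 8).
have {P8} P8 := (has_order cP (isT : 0 < 8)).2 P8.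
have {M8} M8 := (has_order cM (isT : 0 < 8)).2 M8.
have {P10} P10 := (has_order cP (isT : 0 < 10)).2 P10.
have nM : ~ (exists2 s, s \in HM & #[s] = 10) by move/(has_order cM (isT : 0 < 10)); apply/negP.
have nS : ~ (exists2 s, s \in Sym6 & #[s] = 8) by move/ordS; apply/negP.
clear nS8 nM10 ordS.
have nPS : ~~ (HP \isog Sym6) by apply/negP=> /isog_order/(_ P8).
have nMS : ~~ (HM \isog Sym6) by apply/negP=> /isog_order/(_ M8).
have leA : #|[group of Aut Alt6]| <= 4 * #|Inn_Alt6|.
  by rewrite (card_coded cSI) (_ : size A6 = 360); [exact: card_Aut_Alt6 | vm_compute].
exists HP, eP, HM, eM; split=> //; rewrite !exotic_index2 oP oM; split=> // H.
rewrite exotic_index2 => /andP[oH nHS].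
have nSP : HS != HP by apply: contraNneq nPS => <-; rewrite isog_sym.
have nSM : HS != HM by apply: contraNneq nMS => <-; rewrite isog_sym.
have nPM : HP != HM by apply/eqP=> e; rewrite e in P10.
have /or3P[] := index2_over_three leA oH oS oP oM nSP nSM nPM; move/eqP=> e.
- by rewrite e isog_sym isoS in nHS.
- by left.
by right.
Qed.

(* Every element of [lows] comes with a witness [g] and proper subgroups giving
   a lower bound on [P(g, s)], hence on [sigma(g, s)]. *)
Definition sigmaOK (n : nat) (els gens sp M : seq raw)
    (lows : seq (raw * (raw * seq (seq raw)))%type) (k j : nat) : bool :=
  let t := tof (rclos n M) in
  let reps := sp ++ [seq p.1 | p <- lows] in
  [&& repcover n els gens reps, has (fun s => s != iota 0 n) sp,
      all (maxpairOK n els els M M) sp,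
      all (fun r => fcount els t r <= k) reps &&
        has (fun r => (r != iota 0 n) && (fcount els t r == k)) reps,
      all (fun p => lowOK n els els p.2.2 p.1 &&
        [&& p.2.1 \in els, p.2.1 != iota 0 n & k <= lowcount els (tries n p.2.2) p.2.1]) lows,
      all (isord n j) sp & all (fun p => ~~ isord n j p.1) lows].

Lemma sigmaP (gT : finGroupType) (G : {group gT}) enc n els gens sp M lows k j :
    coding G enc n els -> 0 < j -> sigmaOK n els gens sp M lows k j ->
  [/\ sigma G = (k%:R / #|G|%:R)%R, exists2 s, s \in G & #[s] = j
    & forall s, s \in G -> #[s] = j -> s != 1 -> sigma_at G s = sigma G].
Proof.
move=> cG j0 /and4P[rep /hasP[s0 sps0 s01] /allP mp /and4P[cnt /allP low /allP osp /allP olow]].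
have inR s : s \in sp -> s \in sp ++ [seq p.1 | p <- lows] by rewrite mem_cat => ->.
have els_r r := reps_els rep r.
have spE s : s \in sp -> sigma_at G (dec G enc s) = (k%:R / #|G|%:R)%R.
  move=> sps; have sels := els_r _ (inR _ sps); have Gs := decG cG sels.
  by apply: (sigma_at_single cG rep Gs _ cnt); rewrite (decK cG sels); exact: mp.
have lowE p : p \in lows -> (k%:R / #|G|%:R <= sigma_at G (dec G enc p.1))%R.
  move=> lp; have pels : p.1 \in els by apply: els_r; rewrite mem_cat map_f ?orbT.
  have /andP[lo co] := low _ lp; rewrite -(decK cG pels) in lo.
  exact: (sigma_at_low cG (decG cG pels) lo co).
have s0els := els_r _ (inR _ sps0).
have sE : sigma G = (k%:R / #|G|%:R)%R.
  apply: (min_over_eq (dec_ntriv cG s0els s01)); first exact: spE.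
  move=> s /(repcoverP cG rep)[r [y [rr rels Gy ->]]]; rewrite sigma_atJ //.
  move: rr; rewrite mem_cat => /orP[/spE->|/mapP[p lp ->]]; last exact: lowE.
  exact: Order.POrderTheory.lexx.
split=> //.
  exists (dec G enc s0); first exact: (decG cG s0els).
  by apply/eqP; rewrite -(isordE cG j0 (decG cG s0els)) (decK cG s0els) osp.
move=> s Gs os s1; have G's : s \in G^# by rewrite !inE s1.
have [r [y [rr rels Gy es]]] := repcoverP cG rep G's.
rewrite es sigma_atJ // sE; move: rr; rewrite mem_cat => /orP[/spE->//|/mapP[p lp er]].
move/eqP: os; rewrite es orderJ -(isordE cG j0 (decG cG rels)) (decK cG rels) er.
by rewrite (negPf (olow _ lp)).
Qed.

(** The maximum 120 / 720 = 6 / 36 is attained at the outer involutions: 6 of the 36 lie in the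
    dihedral subgroup of order 20. *)
Lemma pgl29_sigmaOK : sigmaOK 10 pgl29_els pgl29_gens pgl29_special pgl29_M pgl29_lows 120 10.
Proof. by vm_compute. Qed.

(** The maximum 80 / 720 = 5 / 45 is attained at the involutions: 5 of the 45 lie in the Sylow
    2-subgroup. *)
Lemma m10_sigmaOK : sigmaOK 10 m10_els m10_gens m10_special m10_M m10_lows 80 8.
Proof. by vm_compute. Qed.

Section SplitIndexTwo.

Variables (gT : finGroupType) (H I : {group gT}).
Hypotheses (sIH : I \subset H) (iHI : #|H : I| = 2).

(** A complement of a subgroup of index 2 has order 2, so splitting is decided by the involutions
    outside [I]. *)
Lemma splits_outer_involution :
  [splits H, over I] <-> exists2 t, t \in H & (t \notin I) && (#[t] == 2).
Proof.
split=> [/splitsP[C /complP[tiIC eH]]|[t Ht /andP[It /eqP ot]]].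
  have cC : #|C| = 2.
    apply/eqP; rewrite -(eqn_pmul2l (cardG_gt0 I)) -(TI_cardMg tiIC) eH.
    by rewrite -(Lagrange sIH) iHI.
  have [t Ct t1] : exists2 t, t \in C & t != 1.
    by apply/trivgPn; rewrite -cardG_gt1 cC.
  exists t; first by rewrite -eH (subsetP (mulG_subr _ _)).
  apply/andP; split.
    apply: contra t1 => It; have : t \in I :&: C by rewrite inE It.
    by rewrite tiIC => /set1P->.
  rewrite eqn_leq order_gt1 t1 andbT -cC; apply: subset_leq_card.
  by rewrite cycle_subG.
apply/splitsP; exists <[t]>%G; apply/complP.
have tiI : I :&: <[t]> = 1.
  by rewrite setIC; apply: prime_TIg; rewrite ?cycle_subG // -orderE ot.
split=> //; apply/eqP; rewrite eqEcard mul_subG ?cycle_subG //=.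
by rewrite (TI_cardMg tiI) -orderE ot -(Lagrange sIH) iHI.
Qed.

End SplitIndexTwo.

Lemma outer_involutionsOK :
  [&& pgl29_outer \in pgl29_els, pgl29_outer \notin psl29_els, isord 10 2 pgl29_outer
    & all (fun e => isord 10 2 e ==> (e \in psl29_els)) m10_els].
Proof. by vm_compute. Qed.

Lemma exotic_A6_ext2_codings : exists HP eP HM eM,
  [/\ coding HP eP 10 pgl29_els, coding HM eM 10 m10_els,
      forall H, is_PGL29 H <-> H = HP & forall H, is_M10 H <-> H = HM].
Proof.
have [HP [eP [HM [eM [[cP cPI cM cMI] [cl xP xM]]]]]] := A6_ext2_classification.
have splE H : exotic_A6_ext2 H ->
    [splits H, over Inn_Alt6] <-> exists2 t, t \in H & (t \notin Inn_Alt6) && (#[t] == 2).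
  by case/and4P=> sI _ /eqP iH _; exact: splits_outer_involution.
have memI (G : {group {perm {perm 'I_6}}}) enc els x : coding G enc 10 els -> Inn_Alt6 \subset G ->
    coding Inn_Alt6 enc 10 psl29_els -> x \in G -> (x \in Inn_Alt6) = (enc x \in psl29_els).
  move=> cG /subsetP sI cI Gx; apply/idP/idP=> [|/(cod_els cI)[y Iy e]].
    exact: (mem_enc cI).
  by rewrite (cod_inj cG Gx (sI _ Iy) e).
have /and4P[sIP _ _ _] := xP; have /and4P[sIM _ _ _] := xM.
have sP : [splits HP, over Inn_Alt6].
  have /and4P[oels opsl oord _] := outer_involutionsOK; have Gt := decG cP oels.
  have et := decK cP oels; have ot := isordE cP (isT : 0 < 2) Gt; rewrite et in ot.
  have It := memI _ _ _ _ cP sIP cPI Gt; rewrite et in It.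
  apply/(splE HP xP); exists (dec HP eP pgl29_outer); first exact: Gt.
  by rewrite It opsl -ot oord.
have sM : ~~ [splits HM, over Inn_Alt6].
  apply/negP=> /(splE HM xM)[t Ht /andP[It ot]]; case/negP: It.
  rewrite (memI _ _ _ _ cM sIM cMI Ht).
  have /and4P[_ _ _ inv] := outer_involutionsOK.
  by have := all_coded cM inv Ht; rewrite (isordE cM (isT : 0 < 2) Ht) ot.
exists HP, eP, HM, eM; split; [exact: cP | exact: cM | |] => H; split.
- by case/andP=> /cl[-> //|->] s; rewrite s in sM.
- by move->; apply/andP.
- by case/andP=> /cl[-> /negP[]|->].
by move->; apply/andP.
Qed.

Theorem mainTheorem5 :
  (* (a) *)
  (sigma Alt6 = (2%:R / 3%:R)%R /\
   (forall s, s \in Alt6^# -> sigma_at Alt6 s = (2%:R / 3%:R)%R <-> #[s] = 5)) /\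
  (* (b) *)
  (forall s, s \in Alt6 -> #[s] = 5 ->
   exists M1 M2 : {group {perm 'I_6}},
     [/\ maximals_containing Alt6 s = [set M1; M2],
         (M2 : {set {perm 'I_6}}) \notin M1 :^: Alt6,
         M1 \isog 'Alt_('I_5) & M2 \isog 'Alt_('I_5)]) /\
  (* (c) *)
  (nongen Alt6 = (5%:R / 9%:R)%R /\
   (forall s, s \in Alt6^# -> nongen_at Alt6 s = (5%:R / 9%:R)%R <-> #[s] = 5)) /\
  (* (d) *)
  (forall g, g \in Alt6 ->
   exists2 x, x \in [set double_transp 1 2 3 4; double_transp 1 3 2 4;
                         double_transp 1 4 2 3]
            & <<[set g; x]>> \proper Alt6) /\
  (* (e) *)
  [/\ spread_exactly Alt6 2, uniform_spread_exactly Alt6 2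
    & exists C, [/\ C \in classes Alt6, (forall s, s \in C -> #[s] = 4)
                  & common_mates_in Alt6 C 2]] /\
  (* (f) *)
  [/\ forall x y, x \in Sym6^# -> y \in Sym6^# ->
      exists2 s, s \in Sym6 & Alt6 \subset <<[set x; s]>> :&: <<[set y; s]>>,
      exists x y, [/\ x \in Sym6^#, y \in Sym6^#
        & forall s, s \in Alt6 ->
          ~~ (Alt6 \subset <<[set x; s]>> :&: <<[set y; s]>>)]
    & forall C, C \in classes Sym6 ->
      exists x y, [/\ x \in Sym6^#, y \in Sym6^#
        & forall s, s \in C ->
          ~~ (Alt6 \subset <<[set x; s]>> :&: <<[set y; s]>>)]] /\
  (* (g) *)
  ((exists H, is_PGL29 H) /\
   (forall H, is_PGL29 H ->
    [/\ sigma H = (1%:R / 6%:R)%R, exists2 s, s \in H & #[s] = 10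
      & forall s, s \in H -> #[s] = 10 -> sigma_at H s = sigma H]) /\
   (exists H, is_M10 H) /\
   (forall H, is_M10 H ->
    [/\ sigma H = (1%:R / 9%:R)%R, exists2 s, s \in H & #[s] = 8
      & forall s, s \in H -> #[s] = 8 -> sigma_at H s = sigma H])).
Proof.
have [HP [eP [HM [eM [cP cM PE ME]]]]] := exotic_A6_ext2_codings.
have sizeP : size pgl29_els = 720 by vm_compute.
have sizeM : size m10_els = 720 by vm_compute.
have [sP oP aP] := sigmaP cP (isT : 0 < 10) pgl29_sigmaOK.
have [sM oM aM] := sigmaP cM (isT : 0 < 8) m10_sigmaOK.
rewrite (card_coded cP) sizeP in sP; rewrite (card_coded cM) sizeM in sM.
have ntriv k (gT : finGroupType) (s : gT) : #[s] = k.+2 -> s != 1.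
  by move=> os; rewrite -order_gt1 os.
split; first by split; [exact: sigma_Alt6 | exact: sigma_at_Alt6].
split; first exact: maximals_Alt6.
split; first by split; [exact: nongen_Alt6 | exact: nongen_at_Alt6].
split; first exact: klein_nongen.
split; first exact: spread_Alt6.
split; first by split; [exact: sym6_mate | exact: sym6_no_even_mate | exact: sym6_no_class_mate].
split; first by exists HP; apply/PE.
split; [|split]; [|by exists HM; apply/ME|].
  move=> H /PE->; split; [|exact: oP|].
    by rewrite sP; exact: (@frac_eq 120 720 1 6 isT isT isT).
  by move=> s Hs os; apply: aP (os) (ntriv _ _ _ os).
move=> H /ME->; split; [|exact: oM|].
  by rewrite sM; exact: (@frac_eq 80 720 1 9 isT isT isT).
by move=> s Hs os; apply: aM (os) (ntriv _ _ _ os).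
Qed.
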